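(* For every $r\in(1,\infty)$, the space $(\mathrm{Diff}_{-\infty}(\mathbb R),F)$ is geodesically convex. More precisely, given any boundary conditions $\varphi(0)=\mathrm{id}\in\mathrm{Diff}_{-\infty}(\mathbb R)$ and $\varphi(1)=\varphi_1\in\mathrm{Diff}_{-\infty}(\mathbb R)$, there exists a unique minimizing geodesic connecting $\mathrm{id}$ to $\varphi_1$.
   Context: $W^{\infty,1}(\mathbb R)=\bigcap_{k\ge 0}W^{k,1}(\mathbb R)$. The group $\mathrm{Diff}_{-\infty}(\mathbb R)=\{\varphi=\mathrm{id}+f: f'\in W^{\infty,1}(\mathbb R),\ f'>-1,\ \lim_{x\to-\infty}f(x)=0\}$ is a Fréchet Lie group with Lie algebra $\mathfrak g_{-\infty}=\{u: u'\in W^{\infty,1}(\mathbb R),\ \lim_{x\to-\infty}u(x)=0\}$. Tangent vectors at $\varphi$ are of the form $h=X\circ\varphi$ with $X\in\mathfrak g_{-\infty}$, and the right-invariant Finsler metric $F$ is $$F_\varphi(h)=\left(\int_{\mathbb R}|(h\circ\varphi^{-1})'|^r\,dx\right)^{1/r}=\left(\int_{\mathbb R}|X'|^r\,dx\right)^{1/r}.$$ The length of a path $\varphi:[0,1]\to\mathrm{Diff}_{-\infty}(\mathbb R)$ is $L(\varphi)=\int_0^1F_\varphi(\varphi_t)\,dt$. Geodesics are paths locally minimizing length, parametrized with constant speed; a minimizing geodesic is one whose length is minimal among all paths in $\mathrm{Diff}_{-\infty}(\mathbb R)$ with the same endpoints. *)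

(* Defs.v *)
(* MathComp-Analysis; the real line is an arbitrary [R : realType]. *)
From mathcomp Require Export all_boot all_order all_algebra.
From mathcomp Require Export all_classical all_reals all_analysis.

Set Implicit Arguments.
Unset Strict Implicit.
Unset Printing Implicit Defensive.

Import Order.TTheory GRing.Theory Num.Theory.
Export numFieldNormedType.Exports.

(* In this order, f^`() is the derivative of a function, not of a polynomial. *)
#[global] Open Scope ring_scope.
#[global] Open Scope classical_set_scope.

Section sobolev.
Context {R : realType}.
Local Notation mu := (@lebesgue_measure R).
Implicit Types u v w : R -> R.

Definition smooth u := forall n x, derivable (u^`(n)) x 1.

Definition test_function u :=
  smooth u /\ exists M : R, forall x, M < `|x| -> u x = 0.

Definition weak_derivative u v := forall psi, test_function psi ->
  (\int[mu]_x (u x * derive1 psi x)%:E = - \int[mu]_x (v x * psi x)%:E)%E.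

Fixpoint sobolev1 (k : nat) u : Prop :=
  mu.-integrable setT (EFin \o u) /\
  if k is k'.+1 then exists v, weak_derivative u v /\ sobolev1 k' v else True.

(* Every class of the intersection of the W^{k,1} has exactly one smooth
   representative, and it is the one meant whenever pointwise values are used. *)
Definition sobolev1_infty u := smooth u /\ forall k, sobolev1 k u.

(* The W^{k,1} norm, on smooth functions. *)
Definition sobolev1_norm (k : nat) u : \bar R :=
  (\sum_(j < k.+1) \int[mu]_x `|derive1n j u x|%:E)%E.

End sobolev.

Section diffeomorphisms.
Context {R : realType}.
Local Notation mu := (@lebesgue_measure R).
Implicit Types (u h : R -> R) (phi : R -> R) (p q : R -> R -> R).

Definition lie_algebra : set (R -> R) := [set u : R -> R |
  [/\ forall x, derivable u x 1,
      sobolev1_infty u^`()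
    & u x @[x --> -oo] --> 0]].

Definition Diff : set (R -> R) := [set phi : R -> R |
  let f := fun x => phi x - x in
  [/\ forall x, derivable f x 1,
      sobolev1_infty f^`(),
      forall x, -1 < f^`() x
    & f x @[x --> -oo] --> 0]].

(* The seminorms defining the Frechet topology of [lie_algebra]. *)
Definition seminorm (k : nat) u : \bar R := sobolev1_norm k u^`().

(* The inverse of phi; [pinv] is a two-sided inverse as every element of [Diff]
   is a bijection of R. *)
Definition diff_inv phi : R -> R := 'pinv_(fun=> 0) setT phi.

Definition finsler (r : R) phi h : \bar R :=
  ((\int[mu]_x (`|derive1 (h \o diff_inv phi) x| `^ r)%:E) `^ r^-1)%E.

(* A path on [a, b] is a function [p : R -> R -> R], [p t] being the
   diffeomorphism at time t; values at times outside [a, b] are irrelevant. *)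

Definition diff_quot p (t s : R) : R -> R :=
  fun x => (s - t)^-1 * (p s x - p t x).

(* The time derivative, one-sided at the end points a and b. *)
Definition velocity (a b : R) p (t : R) : R -> R :=
  fun x => lim (diff_quot p t s x @[s --> within `[a, b] t^']).

(* Curves of class C^1 in [Diff], an open subset of the affine Frechet space
   id + lie_algebra. *)
Definition is_path (a b : R) p := forall t, t \in `[a, b]%R ->
  [/\ Diff (p t),
      lie_algebra (velocity a b p t),
      forall k, seminorm k (diff_quot p t s \- velocity a b p t)
        @[s --> within `[a, b] t^'] --> 0%E
    & forall k, seminorm k (velocity a b p s \- velocity a b p t)
        @[s --> within `[a, b] (nbhs t)] --> 0%E].

Definition speed (r a b : R) p (t : R) : \bar R :=
  finsler r (p t) (velocity a b p t).

Definition path_length (r a b : R) p : \bar R :=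
  (\int[mu]_(t in `[a, b]) speed r a b p t)%E.

Definition minimizing (r a b : R) p := forall q,
  is_path a b q -> q a = p a -> q b = p b ->
  (path_length r a b p <= path_length r a b q)%E.

Definition locally_minimizing (r : R) p := forall t, t \in `[0, 1]%R ->
  exists2 e : R, 0 < e & forall a b : R,
    0 <= a -> a < b -> b <= 1 -> `|a - t| < e -> `|b - t| < e ->
    minimizing r a b p.

Definition constant_speed (r : R) p :=
  exists c : R, forall t, t \in `[0, 1]%R -> speed r 0 1 p t = c%:E.

Definition geodesic (r : R) p :=
  [/\ is_path 0 1 p, constant_speed r p & locally_minimizing r p].

Definition minimizing_geodesic (r : R) p := geodesic r p /\ minimizing r 0 1 p.

Definition joins p phi0 phi1 := p 0 = phi0 /\ p 1 = phi1.

End diffeomorphisms.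

(* Main.v *)
(* The map phi |-> r phi'^(1/r) is an isometry from (Diff, F) into an affine space over L^r,
   and its image is convex, so a segment in L^r is the image of a path of diffeomorphisms:
   the minimizing geodesic from id to phi1 is phi_t' = (1 + t (phi1'^(1/r) - 1))^r. For the
   lower bound on lengths, the velocity of the image of a path is paired with the dual
   function sgn(d) |d|^(r-1) of the difference d of the endpoints; integrating the pairing
   in time gives ||d||_r^r, and Hoelder's inequality bounds it by the speed. As L^r is
   strictly convex for 1 < r, a path of minimal length and constant speed has velocity d.

   The weak derivatives that define W^{k,1} are the classical ones for smooth functions, by
   testing against smooth approximations of the indicators of intervals. *)
Require Import Defs.
From mathcomp Require Import ring lra measurable_realfun.

Set Implicit Arguments.
Unset Strict Implicit.
Unset Printing Implicit Defensive.

Import Order.TTheory GRing.Theory Num.Theory.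

(** * Integrals on the line *)

(** Lengths see [phi'] only through L^r, whereas paths live in a Frechet space; most of the work
    lies between the two. For the segment, every seminorm of the difference quotients must converge.
    Instead of computing higher derivatives, one exhibits a class of functions of (t, x) that is
    stable under both derivations and whose members have integrable bounds uniform in t. All powers,
    negative ones included, stay under control because [phi'] is bounded below by a positive
    constant: [phi' - 1] is continuous, greater than -1, and tends to 0 at both ends of the line.
    For an arbitrary competitor, the dual function is only continuous and bounded, so the pairing is
    differentiated along curves in the intersection of L^1 and C^0. The seminorm of index 1 controls
    both of these norms, and the map y -> r y^(1/r) preserves such curves. Hoelder's inequality and
    the equality case behind uniqueness both come from a single pointwise fact, the tangent
    inequality of |z|^r. *)

Section line_integrals.
Context {R : realType}.
Local Notation mu := (@lebesgue_measure R).
Local Notation L1 u := (mu.-integrable setT (EFin \o u)).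
Implicit Types u v f : R -> R.

Lemma derivable_continuous u : (forall x, derivable u x 1) -> continuous u.
Proof. by move=> du x; exact/differentiable_continuous/derivable1_diffP. Qed.

Lemma L1_measurable u : L1 u -> measurable_fun setT u.
Proof. by move=> /measurable_int/measurable_EFinP. Qed.

Lemma L1_le u v : measurable_fun setT u -> (forall x, `|u x| <= v x) ->
  L1 v -> L1 u.
Proof.
move=> mu_ uv; apply: le_integrable => //; first exact/measurable_EFinP.
by move=> x _; rewrite lee_fin (le_trans (uv x))// ler_norm.
Qed.

Lemma L1Zl k u : L1 u -> L1 (fun x => k * u x).
Proof. exact: integrableZl. Qed.

Lemma L1D u v : L1 u -> L1 v -> L1 (fun x => u x + v x).
Proof. exact: integrableD. Qed.

Lemma L1B u v : L1 u -> L1 v -> L1 (fun x => u x - v x).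
Proof. exact: integrableB. Qed.

Lemma L1_norm u : L1 u -> L1 (fun x => `|u x|).
Proof. exact: integrable_norm. Qed.

Lemma L1_bounded_mul u v (M : R) : measurable_fun setT v ->
  (forall x, `|v x| <= M) -> L1 u -> L1 (fun x => u x * v x).
Proof.
move=> mv vM u1; apply: (@L1_le _ (fun x => M * `|u x|)).
- by apply: measurable_funM => //; exact: L1_measurable.
- by move=> x; rewrite normrM mulrC ler_wpM2r.
- exact/L1Zl/L1_norm.
Qed.

Lemma L1_EFin u : L1 u -> (\int[mu]_x (u x)%:E = (\int[mu]_x u x)%:E)%E.
Proof. by move=> u1; rewrite /Rintegral fineK//; exact: integrable_fin_num. Qed.

Lemma Rintegral_restrict_le f (A : set R) : measurable A ->
  (forall x, 0 <= f x) -> L1 f ->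
  \int[mu]_(x in A) f x <= \int[mu]_x f x.
Proof.
move=> mA f0 f1; rewrite Rintegral_mkcond; apply: le_Rintegral => //.
  by rewrite -restrict_EFin; apply/integrable_restrict => //; rewrite setTI;
    exact: integrableS f1.
move=> x _; rewrite patchE; case: ifPn => // _; exact: f0.
Qed.

Lemma FTC2_segment u a b : (forall x, derivable u x 1) ->
  continuous u^`() -> a <= b -> \int[mu]_(x in `[a, b]) derive1 u x = u b - u a.
Proof.
move=> du cu; rewrite le_eqVlt => /predU1P[->|ab].
  by rewrite subrr set_itv1 Rintegral_set1.
have cu0 := derivable_continuous du.
have cuab : {within `[a, b], continuous u^`()} by exact: continuous_subspaceT.
have uab : derivable_oo_LRcontinuous u a b.
  by split => //; [exact/cvg_at_right_filter/cu0|exact/cvg_at_left_filter/cu0].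
by rewrite /Rintegral (continuous_FTC2 ab cuab uab).
Qed.

Lemma segment_L1 f a b : continuous f ->
  mu.-integrable `[a, b]%classic (EFin \o f).
Proof.
move=> cf; apply: continuous_compact_integrable; first exact: segment_compact.
exact: continuous_subspaceT.
Qed.

Lemma increment_le_segment u a b : (forall x, derivable u x 1) ->
  continuous u^`() -> a <= b ->
  `|u b - u a| <= \int[mu]_(x in `[a, b]) `|derive1 u x|.
Proof.
move=> du cu ab; rewrite -FTC2_segment//.
by apply: le_normr_Rintegral => //; exact: segment_L1.
Qed.

Lemma increment_le u a b : (forall x, derivable u x 1) ->
  continuous u^`() -> L1 u^`() -> `|u b - u a| <= \int[mu]_x `|derive1 u x|.
Proof.
move=> du cu u1; wlog ab : a b / a <= b => [wlg|].
  by case: (leP a b) => [/wlg//|/ltW/wlg]; rewrite distrC.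
apply: (le_trans (increment_le_segment du cu ab)).
by apply: Rintegral_restrict_le => //; exact: L1_norm.
Qed.

Lemma lebesgue_ray_infty (a : R) : (mu `[a, +oo[ = +oo)%E /\ (mu `]-oo, a] = +oo)%E.
Proof. by split; rewrite lebesgue_measure_itv/= ?ltry ?ltNyr. Qed.

(** Otherwise [|u|] would be at least e on a set of infinite measure. Applied to rays, this replaces
    a limit of u at infinity before one is known to exist. *)
Lemma L1_small_on u (e : R) (A : set R) : measurable A -> (mu A = +oo)%E ->
  0 < e -> L1 u -> exists2 x, A x & `|u x| < e.
Proof.
move=> mA muA e0 u1; apply/not_exists2P => ue.
have u1A : mu.-integrable A (EFin \o u) by exact: integrableS u1.
have /integrableP[mu_ /le_lt_trans] := u1A.
have : (e%:E * mu A <= \int[mu]_(x in A) `|(EFin \o u) x|)%E.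
  rewrite -integral_cst//; apply: ge0_le_integral => //=.
  - by move=> x _; rewrite lee_fin ltW.
  - by apply/measurable_EFinP/measurableT_comp => //; exact/measurable_EFinP.
  - by move=> x Ax; rewrite lee_fin leNgt; apply/negP; have [] := ue x.
by rewrite muA mulry gtr0_sg// mul1e => + /(_ _) h => /h; rewrite ltxx.
Qed.

Lemma bounded_by_derivative u x : (forall x, derivable u x 1) ->
  continuous u^`() -> L1 u^`() -> L1 u -> `|u x| <= \int[mu]_x `|derive1 u x|.
Proof.
move=> du cu u1 u0; apply/ler_addgt0Pr => e e0.
have [_ muT] := lebesgue_ray_infty 0.
have [y _ ye] := L1_small_on (measurable_itv _) muT e0 u0.
rewrite -(subrK (u y) (u x)) (le_trans (ler_normD _ _))// lerD//; last exact: ltW.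
exact: increment_le.
Qed.

(** Monotone convergence along the segments [-n, n]: the complement of one of them carries mass
    below e. *)
Lemma L1_tail u (e : R) : 0 < e -> L1 u -> exists M : R,
  forall A, measurable A -> A `&` `[-M, M] = set0 -> \int[mu]_(x in A) `|u x| < e.
Proof.
move=> e0 u1; have nu1 := L1_norm u1.
pose F (n : nat) : set R := `[- n%:R, n%:R]%classic.
have ndF : nondecreasing_seq F.
  move=> m n mn; rewrite subsetEset; apply: subset_itv; rewrite bnd_simp.
    by rewrite lerN2 ler_nat.
  by rewrite ler_nat.
have UF : \bigcup_n F n = setT.
  rewrite -subTset => x _; exists (Num.truncn `|x|).+1 => //=.
  by rewrite /F/= in_itv/= -ler_norml ltW// truncnS_gt.
have mnu A : measurable_fun A (fun x => (`|u x|)%:E).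
  by apply: measurable_funTS; exact: (measurable_int mu nu1).
have := @ge0_nondecreasing_set_cvg_integral _ (measurableTypeR R) R F (fun x => (`|u x|)%:E) mu
  ndF (fun=> measurable_itv _) (fun=> mnu _) (fun _ _ _ => normr_ge0 _).
rewrite UF L1_EFin// => /fine_cvg /cvgr_gt /(_ (\int[mu]_x `|u x| - e)).
rewrite gtrBl e0 => /(_ isT)[N _ /(_ N (leqnn _))] NF.
exists N%:R => A mA AN.
have iS (B : set R) : measurable B -> mu.-integrable B (EFin \o (fun x => `|u x|)).
  by move=> mB; exact: integrableS nu1.
have mF : measurable (F N) by exact: measurable_itv.
have := @Rintegral_restrict_le (fun x => `|u x|) _ (measurableU _ _ mA mF)
  (fun=> normr_ge0 _) nu1.
rewrite Rintegral_setU//; last 2 first.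
- by apply: iS; exact: measurableU.
- by rewrite disj_set2E AN.
move=> /le_lt_trans AF; rewrite -(ltrD2r (\int[mu]_(x in F N) `|u x|)).
by apply: AF; rewrite addrC -ltrBlDr.
Qed.

Lemma increment_le_on (A : set R) u a b : (forall x, derivable u x 1) ->
  continuous u^`() -> L1 u^`() -> measurable A -> a <= b -> `[a, b] `<=` A ->
  `|u b - u a| <= \int[mu]_(x in A) `|derive1 u x|.
Proof.
move=> du cu u1 mA ab abA; apply: (le_trans (increment_le_segment du cu ab)).
rewrite Rintegral_mkcond [leRHS]Rintegral_mkcond.
have iS (B : set R) : measurable B -> L1 ((fun x => `|derive1 u x|) \_ B).
  move=> mB; rewrite -restrict_EFin; apply/integrable_restrict => //.
  by rewrite setTI; apply: integrableS (L1_norm u1).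
apply: le_Rintegral => //; [exact: (iS _ (measurable_itv _))|exact: iS|].
move=> x _; rewrite !patchE; case: ifPn => [|_]; first by rewrite inE => /abA xA; rewrite mem_set.
by case: ifPn => _; [exact: normr_ge0|exact: lexx].
Qed.

(** Far out, the oscillation of u on a ray is bounded by the tail of the integral of [|u'|], and
    every ray contains points where u is small. *)
Lemma L1_cvg0 u : (forall x, derivable u x 1) ->
  continuous u^`() -> L1 u^`() -> L1 u ->
  u x @[x --> -oo] --> 0 /\ u x @[x --> +oo] --> 0.
Proof.
move=> du cu u1 u0.
split; apply/cvgr0Pnorm_lt => e e0; have e20 : 0 < e / 2 by rewrite divr_gt0.
all: have [M tM] := L1_tail e20 u1.
- exists (- M); split; first exact: num_real.
  move=> x xM /=; have [_ muT] := lebesgue_ray_infty x.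
  have [y yx ye] := L1_small_on (measurable_itv _) muT e20 u0.
  rewrite /= in_itv/= in yx.
  have : `|u x - u y| < e / 2.
    apply: (le_lt_trans (increment_le_on (A := `]-oo, x]%classic) du cu u1 _ yx _)).
    + exact: measurable_itv.
    + by move=> z; rewrite /= !in_itv/= => /andP[].
    + apply: tM; first exact: measurable_itv.
      rewrite -subset0 => z []; rewrite /= !in_itv/=; lra.
  have := ler_normD (u x - u y) (u y); rewrite subrK; lra.
- exists M; split; first exact: num_real.
  move=> x xM /=; have [muT _] := lebesgue_ray_infty x.
  have [y yx ye] := L1_small_on (measurable_itv _) muT e20 u0.
  rewrite /= in_itv/= andbT in yx.
  have : `|u x - u y| < e / 2.
    rewrite distrC.
    apply: (le_lt_trans (increment_le_on (A := `[x, +oo[%classic) du cu u1 _ yx _)).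
    + exact: measurable_itv.
    + by move=> z; rewrite /= !in_itv/= => /andP[->].
    + apply: tM; first exact: measurable_itv.
      rewrite -subset0 => z []; rewrite /= !in_itv/=; lra.
  have := ler_normD (u x - u y) (u y); rewrite subrK; lra.
Qed.

(** Normalized at -oo like the elements of [lie_algebra], so that it inverts derivation there. *)
Definition primitive f (x : R) : R := \int[mu]_(t in `]-oo, x]) f t.

Lemma primitive_is_derive f (x : R) : continuous f -> L1 f ->
  is_derive x (1 : R) (primitive f) (f x).
Proof.
move=> cf f1; have [|//||//|dF F'] := @continuous_FTC1 R f -oo%O x (x + 1).
- by rewrite ltrDl.
- by apply: integrableS f1.
- by rewrite ltNyr.
- exact: cf.
by have := derivableP dF; rewrite -derive1E F'.
Qed.

Lemma primitive_cvg0 f : L1 f -> primitive f x @[x --> -oo] --> 0.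
Proof.
move=> f1; apply/cvgr0Pnorm_lt => e e0; have [M tM] := L1_tail e0 f1.
exists (- M); split; first exact: num_real.
move=> x xM /=; apply: (le_lt_trans (le_normr_Rintegral _ _)) => //.
  by apply: integrableS f1.
apply: tM; first exact: measurable_itv.
rewrite -subset0 => z []; rewrite /= !in_itv/=; lra.
Qed.

Lemma derive1_cvgNy_unique u v : (forall x, derivable u x 1) ->
  (forall x, derivable v x 1) -> u^`() =1 v^`() ->
  u x - v x @[x --> -oo] --> 0 -> u = v.
Proof.
move=> du dv uv uv0.
have duv x : is_derive x (1 : R) (fun x => u x - v x) 0.
  rewrite -[0](subrr (derive1 u x)) {2}uv !derive1E.
  by apply: is_deriveB; exact: derivableP.
apply/funext => x; apply/eqP; rewrite -subr_eq0; apply/eqP.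
have uvx : (fun y => u y - v y) = (fun=> u x - v x).
  by apply/funext => y; exact: is_derive_0_is_cst.
have : u x - v x @[_ --> (-oo : set_system R)] --> u x - v x by exact: cvg_cst.
by rewrite -uvx => /cvg_unique; apply.
Qed.

(** The variant for functions such as velocities, which vanish at -oo but may have a nonzero limit
    at +oo and so fail to be integrable. *)
Lemma bounded_by_derivative_cvgNy u x : (forall x, derivable u x 1) ->
  continuous u^`() -> L1 u^`() -> u x @[x --> -oo] --> 0 ->
  `|u x| <= \int[mu]_x `|derive1 u x|.
Proof.
move=> du cu u1 /cvgr0Pnorm_lt u0; apply/ler_addgt0Pr => e /u0[M [_ Me]].
have /Me/= ye : M - 1 < M by rewrite ltrBlDr ltrDl.
rewrite -(subrK (u (M - 1)) (u x)) (le_trans (ler_normD _ _))// lerD//; last exact: ltW.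
exact: increment_le.
Qed.

End line_integrals.

(** * Test functions and weak derivatives *)

Section smooth_functions.
Context {R : realType}.
Local Notation mu := (@lebesgue_measure R).
Local Notation L1 u := (mu.-integrable setT (EFin \o u)).
Implicit Types u v f psi : R -> R.

Lemma is_derive_derive1 u (x l : R) : is_derive x (1 : R) u l -> u^`() x = l.
Proof. by move=> ul; rewrite derive1E derive_val. Qed.

Lemma derivable_is_derive u (x : R) : derivable u x 1 ->
  is_derive x (1 : R) u (u^`() x).
Proof. by move=> du; rewrite derive1E; exact: derivableP. Qed.

Lemma eq_is_derive u v (x l m : R) : u =1 v -> l = m ->
  is_derive x (1 : R) u l -> is_derive x (1 : R) v m.
Proof. by move=> /funext -> ->. Qed.

(** A coinduction principle: smoothness follows from membership in a class stable under derivation,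
    with no formula for the n-th derivative. *)
Lemma smooth_derive1n (C : set (R -> R)) :
  (forall u, C u -> exists2 v, C v & forall x : R, is_derive x (1 : R) u (v x)) ->
  forall u, C u -> smooth u /\ forall n, C u^`(n).
Proof.
move=> HC; have CE u : C u -> (forall x, derivable u x 1) /\ C u^`().
  move=> /HC[v Cv uv]; split=> [x|]; first by case: (uv x).
  by rewrite (_ : u^`() = v)//; apply/funext => x; exact: is_derive_derive1.
have Cn u n : C u -> C u^`(n).
  by move=> Cu; elim: n => [//|n IH]; rewrite derive1nS; exact: (CE _ IH).2.
by move=> u Cu; split=> n; [exact: (CE _ (Cn _ n Cu)).1|exact: Cn].
Qed.

Lemma smooth_derivable u : smooth u -> forall x, derivable u x 1.
Proof. by move=> su x; exact: (su 0). Qed.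

Lemma smooth_derive1 u : smooth u -> smooth u^`().
Proof. by move=> su n; rewrite -derive1Sn. Qed.

Lemma smooth_continuous u : smooth u -> continuous u.
Proof. by move=> su; exact/derivable_continuous/smooth_derivable. Qed.

Inductive subalgebra (B : set (R -> R)) : set (R -> R) :=
| subalgebra_gen u of B u : subalgebra B u
| subalgebra_cst (c : R) : subalgebra B (fun=> c)
| subalgebraD u v of subalgebra B u & subalgebra B v :
    subalgebra B (fun x => u x + v x)
| subalgebraM u v of subalgebra B u & subalgebra B v :
    subalgebra B (fun x => u x * v x).

(** By the Leibniz rule the algebra is stable under derivation as soon as it contains the
    derivatives of its generators. *)
Lemma subalgebra_smooth (B : set (R -> R)) :
  (forall u, B u ->
    exists2 v, subalgebra B v & forall x : R, is_derive x (1 : R) u (v x)) ->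
  forall u, subalgebra B u -> smooth u.
Proof.
move=> HB u Bu; apply: (smooth_derive1n _ Bu).1 => {Bu}.
move=> {}u; elim => [{}u /HB//|c|{}u v Bu [u' Bu' uu'] Bv [v' Bv' vv']|
                     {}u v Bu [u' Bu' uu'] Bv [v' Bv' vv']].
- exists (fun=> 0); first exact: subalgebra_cst.
  by move=> x; exact: is_derive_cst.
- exists (fun x => u' x + v' x); first exact: subalgebraD.
  by move=> x; exact: is_deriveD.
- exists (fun x => u x * v' x + v x * u' x).
    by apply: subalgebraD; exact: subalgebraM.
  by move=> x; exact: is_deriveM.
Qed.

(* [flat 0] is exp(-1/x) extended by 0; the derivatives of [flat n] are combinations of the
   [flat m]. *)
Definition flat (n : nat) (x : R) : R :=
  if 0 < x then x^-1 ^+ n * expR (- x^-1) else 0.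

(** The term of degree n + 1 of the exponential series bounds x^-(n+1) by (n+1)! exp(1/x). This
    gives continuity at 0. *)
Lemma flat_le n (x : R) : `|flat n x| <= n.+1`!%:R * `|x|.
Proof.
rewrite /flat; case: ifPn => [x0|_]; last by rewrite normr0 mulr_ge0.
have y0 : 0 < x^-1 by rewrite invr_gt0.
rewrite ger0_norm; last by rewrite mulr_ge0// ?exprn_ge0 ?expR_ge0 ?ltW.
rewrite (gtr0_norm x0) expRN ler_pdivrMr ?expR_gt0//.
have := @expR_ge1Dxn R x^-1 n (ltW y0).
have n0 : 0 < n.+1`!%:R :> R by rewrite ltr0n fact_gt0.
move=> h; have : x^-1 ^+ n.+1 <= n.+1`!%:R * expR x^-1.
  by rewrite mulrC -ler_pdivrMr//; apply: le_trans h; rewrite lerDr.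
rewrite exprSr ler_pdivrMr// => h1.
by rewrite mulrAC.
Qed.

Lemma flat_continuous0 n : {for 0, continuous (flat n)}.
Proof.
suff : flat n x @[x --> (0 : R)] --> (0 : R).
  by rewrite -[X in _ --> X -> _](_ : flat n 0 = 0)// /flat ltxx.
have c0 : n.+1`!%:R * `|x| @[x --> (0 : R)] --> (0 : R).
  have : `|x| @[x --> (0 : R)] --> `|0 : R| by apply: cvg_norm; exact: cvg_id.
  move=> c; have := cvgMl_tmp (a := n.+1`!%:R : R) c; rewrite normr0 mulr0; apply.
apply: (@squeeze_cvgr _ _ _ _ (fun x => - (n.+1`!%:R * `|x|)) (fun x => n.+1`!%:R * `|x|)).
- by apply: nearW => x; rewrite -ler_norml flat_le.
- by rewrite -[X in _ --> X]oppr0; exact: cvgN.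
- exact: c0.
Qed.

Lemma is_derive_flat n (x : R) :
  is_derive x (1 : R) (flat n) (flat n.+2 x - n%:R * flat n.+1 x).
Proof.
have [x0|x0|->] := ltrgt0P x; last 1 first.
- rewrite {2 3}/flat ltxx mulr0 subr0; apply/is_derive1_caratheodory.
  (* Since [flat n z = z * flat n.+1 z] for all z, the slope function at 0 is [flat n.+1], which is
     continuous there with value 0. *)
  exists (flat n.+1); split.
  + move=> z; rewrite /flat ltxx !subr0; case: ifPn => z0; last by rewrite mul0r.
    by rewrite exprSr (mulrAC _ z^-1) mulfVK ?gt_eqF.
  + exact: flat_continuous0.
  + by rewrite /flat ltxx.
- have xn0 : x != 0 by rewrite gt_eqF.
  apply: (@near_eq_is_derive R R R (fun z : R => z^-1 ^+ n * expR (- z^-1))).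
  + near=> z; rewrite /flat ifT//; near: z; exact: lt_nbhsr.
  + rewrite /flat x0.
    have dV : is_derive x (1 : R) (fun z : R => z^-1) (- x ^- 2).
      apply: eq_is_derive (is_deriveV xn0 (is_derive_id x 1)) => //.
      by rewrite /GRing.scale/= mulr1.
    have dE : is_derive x (1 : R) (fun z : R => expR (- z^-1)) (expR (- x^-1) * x ^- 2).
      have := @is_derive1_comp R expR (fun z => - z^-1) x _ _
        (is_derive_expR _) (is_deriveN dV).
      by apply: eq_is_derive => //; rewrite opprK.
    have dX := is_deriveX n dV.
    have := is_deriveM dX dE; apply: eq_is_derive.
      by move=> z; rewrite !fctE.
    rewrite !fctE /GRing.scale/=; case: n dX => [|n] dX.
      by rewrite !mul0r mulr0 !expr0 addr0 subr0 mul1r mulrC exprVn.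
    by rewrite /= -!exprVn !exprS expr0 mulr1; ring.
- apply: (@near_eq_is_derive R R R (fun=> 0)).
  + near=> z; rewrite /flat ifF//; apply/negbTE; rewrite -leNgt ltW//.
    by near: z; exact: lt_nbhsl.
  + rewrite /flat ltNge ltW//= mulr0 subr0; exact: is_derive_cst.
Unshelve. all: by end_near. Qed.

Lemma flat0_itv (x : R) : 0 <= flat 0 x <= 1.
Proof.
rewrite /flat; case: ifPn => x0; last by rewrite lexx ler01.
rewrite expr0 mul1r expR_ge0.
by rewrite expR_le1 oppr_le0 invr_ge0 ltW.
Qed.

Lemma flat0_gt0 (x : R) : 0 < x -> 0 < flat 0 x.
Proof. by move=> x0; rewrite /flat x0 expr0 mul1r expR_gt0. Qed.

Lemma flat0_eq0 (x : R) : x <= 0 -> flat 0 x = 0.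
Proof. by rewrite /flat leNgt => /negbTE ->. Qed.

(* Smooth functions increasing with n to the indicator of ]a, b[. *)
Definition plateau (a b : R) (n : nat) (x : R) : R :=
  1 - (1 - flat 0 (x - a) * flat 0 (b - x)) ^+ n.

Lemma plateau_test_function a b n : test_function (plateau a b n).
Proof.
(* By [is_derive_flat] the derivatives of these generators are linear combinations of generators,
   and a plateau is a polynomial in them. *)
pose B : set (R -> R) := [set u | exists m, u = (fun x => flat m (x - a)) \/
                                            u = (fun x => flat m (b - x))].
have Bl m : subalgebra B (fun x => flat m (x - a)).
  by apply: subalgebra_gen; exists m; left.
have Br m : subalgebra B (fun x => flat m (b - x)).
  by apply: subalgebra_gen; exists m; right.
have BB u v (c : R) : subalgebra B u -> subalgebra B v ->
    subalgebra B (fun x => u x + c * v x).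
  move=> Bu Bv; apply: subalgebraD => //.
  by apply: subalgebraM => //; exact: subalgebra_cst.
split.
- apply: (@subalgebra_smooth B).
  + move=> _ [m [->|->]].
    * exists (fun x => flat m.+2 (x - a) + - m%:R * flat m.+1 (x - a)).
        exact: (BB (fun x => flat m.+2 (x - a)) (fun x => flat m.+1 (x - a))).
      move=> x; have dB := is_deriveB (is_derive_id x (1 : R)) (is_derive_cst a x (1 : R)).
      have := @is_derive1_comp R (flat m) (fun z => z - a) x _ _ (is_derive_flat m _) dB.
      by apply: eq_is_derive => //; rewrite subr0 mulr1 mulNr.
    * exists (fun x => (-1) * flat m.+2 (b - x) + m%:R * flat m.+1 (b - x)).
        apply: (BB (fun x => (-1) * flat m.+2 (b - x)) (fun x => flat m.+1 (b - x))) => //.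
        by apply: subalgebraM => //; exact: subalgebra_cst.
      move=> x; have dB := is_deriveB (is_derive_cst b x (1 : R)) (is_derive_id x (1 : R)).
      have := @is_derive1_comp R (flat m) (fun z => b - z) x _ _ (is_derive_flat m _) dB.
      by apply: eq_is_derive => //; ring.
  + have Bp : subalgebra B (fun x => 1 + (-1) * (flat 0 (x - a) * flat 0 (b - x))).
      apply: (BB (fun=> 1) (fun x => flat 0 (x - a) * flat 0 (b - x))).
        exact: subalgebra_cst.
      exact: subalgebraM.
    have Bpn : subalgebra B (fun x => (1 + (-1) * (flat 0 (x - a) * flat 0 (b - x))) ^+ n).
      elim: n => [|n IH]; first exact: (subalgebra_cst B 1).
      have := subalgebraM Bp IH; congr (subalgebra _ _).
      by apply/funext => x; rewrite exprS.
    have := BB _ _ (-1) (subalgebra_cst B 1) Bpn; congr (subalgebra _ _).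
    by apply/funext => x; rewrite /plateau !mulN1r.
- exists (`|a| + `|b|) => x abx; rewrite /plateau.
  suff -> : flat 0 (x - a) * flat 0 (b - x) = 0 by rewrite subr0 expr1n subrr.
  have [xa|xa] := leP x a; first by rewrite flat0_eq0 ?mul0r// subr_le0.
  rewrite [X in _ * X]flat0_eq0 ?mulr0// subr_le0 leNgt; apply/negP => xb.
  have : `|x| <= `|a| + `|b|.
    have [x0|x0] := leP 0 x.
      by rewrite ger0_norm// ler_wpDl// (le_trans (ltW xb))// ler_norm.
    by rewrite ltr0_norm// ler_wpDr// -normrN (le_trans _ (ler_norm _))// lerN2 ltW.
  by rewrite leNgt abx.
Qed.

Lemma plateau_itv a b n x : 0 <= plateau a b n x <= 1.
Proof.
have /andP[p0 p1] := flat0_itv (x - a); have /andP[q0 q1] := flat0_itv (b - x).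
have h0 : 0 <= 1 - flat 0 (x - a) * flat 0 (b - x) by rewrite subr_ge0 mulr_ile1.
rewrite /plateau subr_ge0 gerBl exprn_ge0// exprn_ile1//.
by rewrite gerBl mulr_ge0.
Qed.

Lemma plateau_out a b n x : ~ `]a, b[%classic x -> plateau a b n x = 0.
Proof.
rewrite /= in_itv/= => xab; rewrite /plateau.
suff -> : flat 0 (x - a) * flat 0 (b - x) = 0 by rewrite subr0 expr1n subrr.
have [xa|xa] := leP x a; first by rewrite flat0_eq0 ?mul0r// subr_le0.
rewrite [X in _ * X]flat0_eq0 ?mulr0// subr_le0 leNgt; apply/negP => xb.
by apply: xab; rewrite xa.
Qed.

Lemma plateau_cvg a b x :
  plateau a b n x @[n --> \oo] --> (\1_(`]a, b[%classic : set R) x : R).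
Proof.
rewrite indicE; have [/set_mem|/negP] := boolP (x \in _); last first.
  rewrite inE => xab; rewrite (_ : plateau a b ^~ x = fun=> 0); first exact: cvg_cst.
  by apply/funext => n; exact: plateau_out.
rewrite /= in_itv/= => /andP[ax xb]; rewrite -[X in _ --> X]subr0.
apply: cvgB; first exact: cvg_cst.
have pgt0 : 0 < flat 0 (x - a) * flat 0 (b - x).
  by rewrite mulr_gt0// flat0_gt0// subr_gt0.
have /andP[p0 p1] := flat0_itv (x - a); have /andP[q0 q1] := flat0_itv (b - x).
apply: cvg_expr; rewrite ger0_norm ?gtrBl// subr_ge0.
by rewrite mulr_ile1.
Qed.

Lemma plateau_abs_le1 a b n x : `|plateau a b n x| <= 1.
Proof. by have /andP[p0 p1] := plateau_itv a b n x; rewrite ger0_norm. Qed.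

Lemma test_function_continuous psi : test_function psi -> continuous psi.
Proof. by case=> + _; exact: smooth_continuous. Qed.

Lemma compact_support_L1 u : continuous u ->
  (exists M : R, forall x, M < `|x| -> u x = 0) -> L1 u.
Proof.
move=> cu [M uM]; apply: (@eq_integrable _ _ _ mu _ _ ((EFin \o u) \_ `[- M, M])) => //.
  move=> x _; rewrite patchE; case: ifPn => //.
  rewrite notin_setE/= in_itv/= -ler_norml => /negP.
  by rewrite -ltNge => /uM /= ->.
apply/integrable_restrict => //; rewrite setTI; exact: segment_L1.
Qed.

Lemma compact_support_derive1 u (M : R) : (forall x, M < `|x| -> u x = 0) ->
  forall x, M < `|x| -> u^`() x = 0.
Proof.
move=> uM x Mx; apply: is_derive_derive1.
apply: (@near_eq_is_derive R R R (cst 0)).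
have : continuous (fun x : R => `|x|) by move=> y; exact: cvg_norm.
move=> /(_ x)/cvgr_gt/(_ _ Mx); apply: filterS => z /uM -> //.
Qed.

Lemma Rintegral_derive1_compact_support u : (forall x, derivable u x 1) ->
  continuous u^`() -> (exists M : R, forall x, M < `|x| -> u x = 0) ->
  \int[mu]_x derive1 u x = 0.
Proof.
move=> du cu [M uM]; have u'M := compact_support_derive1 uM.
(* M may be negative, and u is known to vanish only where [|x|] exceeds M strictly. *)
pose N := `|M| + 1.
have N0 : 0 <= N by rewrite addr_ge0.
have MN : M < `|N| by rewrite (ger0_norm N0) ltr_pwDr// ler_norm.
have -> : \int[mu]_x derive1 u x = \int[mu]_(x in `[- N, N]) derive1 u x.
  rewrite [RHS]Rintegral_mkcond; congr (fine _); apply: eq_integral => x _.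
  rewrite patchE; case: ifPn => //; rewrite notin_setE/= in_itv/= -ler_norml => /negP.
  by rewrite -ltNge => Nx; rewrite u'M// (lt_trans _ Nx)// -(ger0_norm N0).
rewrite FTC2_segment//; last by rewrite ge0_cp.
by rewrite !uM ?subrr// normrN.
Qed.

Lemma test_function_by_parts u psi : smooth u -> test_function psi ->
  [/\ L1 (fun x => u x * derive1 psi x), L1 (fun x => derive1 u x * psi x) &
      \int[mu]_x (u x * derive1 psi x) = - \int[mu]_x (derive1 u x * psi x)].
Proof.
move=> su [sp [M pM]]; have p'M := compact_support_derive1 pM.
have [cu cu'] := (smooth_continuous su, smooth_continuous (smooth_derive1 su)).
have [cp cp'] := (smooth_continuous sp, smooth_continuous (smooth_derive1 sp)).
have i1 : L1 (fun x => u x * derive1 psi x).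
  apply: compact_support_L1; first by move=> x; apply: cvgM; [exact: cu|exact: cp'].
  by exists M => x /p'M ->; rewrite mulr0.
have i2 : L1 (fun x => derive1 u x * psi x).
  apply: compact_support_L1; first by move=> x; apply: cvgM; [exact: cu'|exact: cp].
  by exists M => x /pM ->; rewrite mulr0.
split => //.
have dup x : is_derive x (1 : R) (fun x => u x * psi x)
    (u x * derive1 psi x + derive1 u x * psi x).
  have := is_deriveM (derivable_is_derive (@smooth_derivable _ su x))
    (derivable_is_derive (@smooth_derivable _ sp x)).
  by apply: eq_is_derive => //; rewrite /GRing.scale/= [X in _ + X]mulrC.
have dE : (fun x => u x * psi x)^`() =
    (fun x => u x * derive1 psi x + derive1 u x * psi x).
  by apply/funext => x; exact: is_derive_derive1.
have := @Rintegral_derive1_compact_support (fun x => u x * psi x).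
rewrite dE RintegralD// => h.
apply/eqP; rewrite -addr_eq0; apply/eqP; apply: h.
- by move=> x; case: (dup x).
- by move=> x; apply: cvgD; apply: cvgM; [exact: cu|exact: cp'|exact: cu'|exact: cp].
- by exists M => x /pM ->; rewrite mulr0.
Qed.

Lemma plateau_continuous a b n : continuous (plateau a b n).
Proof. exact/test_function_continuous/plateau_test_function. Qed.

(** Dominated convergence: the plateaus vanish outside []a, b[] and are at most 1, so the
    restriction of [|u|] to this interval dominates. *)
Lemma plateau_cvg_integral u (a b : R) : measurable_fun setT u ->
  mu.-integrable `]a, b[%classic (EFin \o u) ->
  \int[mu]_x (u x * plateau a b n x) @[n --> \oo] --> \int[mu]_(x in `]a, b[) u x.
Proof.
move=> mu_ iu; have mI : measurable (`]a, b[%classic : set R) by exact: measurable_itv.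
have iu' : L1 (u \_ `]a, b[%classic).
  by rewrite -restrict_EFin; apply/integrable_restrict => //; rewrite setTI.
have pE n x : u x * plateau a b n x = (u \_ `]a, b[%classic) x * plateau a b n x.
  rewrite patchE; case: ifPn => //; rewrite notin_setE => /plateau_out ->.
  by rewrite !mulr0.
rewrite [X in _ --> X]Rintegral_mkcond.
apply: fine_cvg; rewrite -L1_EFin//.
have [|||||_ _] := @dominated_convergence _ _ R mu setT measurableT
  (fun n x => (u x * plateau a b n x)%:E) (EFin \o (u \_ `]a, b[%classic))
  (fun x => (`|(u \_ `]a, b[%classic) x|)%:E); last exact.
- move=> n; apply/measurable_EFinP; apply: measurable_funM => //.
  by apply: continuous_measurable_fun; exact: plateau_continuous.
- exact: measurable_int iu'.
- apply: aeW => x _; apply: cvg_EFin; first exact: nearW.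
  rewrite (_ : (u \_ _) x = u x * \1_(`]a, b[%classic : set R) x); last first.
    by rewrite patchE indicE; case: ifPn => _; rewrite ?mulr1// mulr0.
  by apply: cvgMl_tmp; exact: plateau_cvg.
- exact: L1_norm.
- apply: aeW => x n _; rewrite lee_fin pE normrM ler_piMr//.
  exact: plateau_abs_le1.
Qed.

Lemma test_function_eq_segment (w v : R -> R) : continuous w -> L1 v ->
  (forall psi, test_function psi ->
    \int[mu]_x (w x * psi x) = \int[mu]_x (v x * psi x)) ->
  forall a b : R, \int[mu]_(x in `]a, b[) w x = \int[mu]_(x in `]a, b[) v x.
Proof.
move=> cw v1 wv a b.
have iw : mu.-integrable `]a, b[%classic (EFin \o w).
  apply: integrableS (segment_L1 a b cw) => //; exact: subset_itv_oo_cc.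
have iv : mu.-integrable `]a, b[%classic (EFin \o v).
  by apply: integrableS v1.
have := plateau_cvg_integral (continuous_measurable_fun cw) iw.
have := plateau_cvg_integral (L1_measurable v1) iv.
rewrite (_ : (fun n => _) = (fun n => \int[mu]_x (w x * plateau a b n x))).
  by move=> h1 h2; apply: (cvg_unique _ h2 h1).
by apply/funext => n; rewrite wv//; exact: plateau_test_function.
Qed.

(** As v and w have equal integrals over bounded intervals, the primitive W of v has derivative w
    everywhere, w being continuous. It has derivative v almost everywhere by Lebesgue's
    differentiation theorem, so v = w almost everywhere. *)
Lemma test_function_eq_L1 (w v : R -> R) : continuous w -> L1 v ->
  (forall psi, test_function psi ->
    \int[mu]_x (w x * psi x) = \int[mu]_x (v x * psi x)) -> L1 w.
Proof.
move=> cw v1 wv.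
pose W x := \int[mu]_(t in `]-oo, x]) v t.
have iv (A : set R) : measurable A -> mu.-integrable A (EFin \o v).
  by move=> mA; exact: integrableS v1.
have iw (a b : R) : mu.-integrable `[a, b]%classic (EFin \o w) by exact: segment_L1.
have Ww (x : R) : W^`() x = w x.
  have xx1 : x < x + 1 by rewrite ltrDl.
  have [|//|dF F'] := @continuous_FTC1_closed R w (x - 1) x (x + 1) xx1 (iw _ _).
  - by rewrite ltrBlDr ltrDl.
  - exact: cw.
  have := derivable_is_derive dF; rewrite F' => dFw.
  have := is_deriveD (is_derive_cst (W (x - 1)) x (1 : R)) dFw.
  rewrite add0r => h; apply: is_derive_derive1.
  apply: near_eq_is_derive h; near=> y; rewrite /= fctE.
  have xy : x - 1 < y.
    by near: y; apply: lt_nbhsr; rewrite ltrBlDr ltrDl.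
  rewrite -[LHS]/(W (x - 1) + \int[mu]_(t in `[x - 1, y]) w t).
  (* The endpoints are dropped because plateaus compare integrals over open intervals. *)
  rewrite -Rintegral_itv_obnd_cbnd; last first.
    by apply: integrableS (iw (x - 1) y) => //; exact: subset_itv_oc_cc.
  rewrite -Rintegral_itv_bndo_bndc; last first.
    by apply: integrableS (iw (x - 1) y) => //; exact: subset_itv_oo_cc.
  rewrite (test_function_eq_segment cw v1 wv) Rintegral_itv_bndo_bndc//; last exact: iv.
  rewrite -(@Rintegral_itvB R v -oo%O)//; first by rewrite addrC subrK.
  - exact: iv.
  - by rewrite bnd_simp ltW.
have aevw : ae_eq mu setT (EFin \o v) (EFin \o w).
  have := @FTC1Ny R v (fun y => iv _ (measurable_itv _)) (open_integrable_locally openT v1).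
  apply: filterS; first exact: (ae_filter_ringOfSetsType mu).
  by move=> x [_ Wv] _ /=; rewrite -Ww -Wv.
have mw := continuous_measurable_fun cw.
apply/integrableP; split; first exact/measurable_EFinP.
have /integrableP[mv] := v1; congr (_ < _)%E.
apply: ae_eq_integral => //.
- exact: measurableT_comp.
- by apply: measurableT_comp => //; exact/measurable_EFinP.
- exact: ae_eq_abse.
Unshelve. all: by end_near. Qed.

(** The weak derivatives in [sobolev1] are arbitrary representatives, so the induction carries a
    smooth w and some v that agree against test functions. Integration by parts for w and the weak
    derivative of v pass this agreement on to [w'] and [v']. *)
Lemma smooth_sobolev1_L1 k w v : smooth w ->
  (forall psi, test_function psi ->
    \int[mu]_x (w x * psi x) = \int[mu]_x (v x * psi x)) ->
  sobolev1 k v -> forall n, (n <= k)%N -> L1 w^`(n).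
Proof.
elim: k w v => [|k IH] w v sw wv.
  case=> v1 _ n; rewrite leqn0 => /eqP ->.
  by apply: test_function_eq_L1 wv => //; exact: smooth_continuous.
case=> v1 [v' [vv' sv']] [_|n nk].
  by apply: test_function_eq_L1 wv => //; exact: smooth_continuous.
rewrite derive1Sn; apply: (IH _ v' (smooth_derive1 sw) _ sv' n nk) => psi tpsi.
have [_ _ ibp] := test_function_by_parts sw tpsi.
have tpsi' : test_function psi^`().
  case: tpsi => sp [M pM]; split; first exact: smooth_derive1.
  by exists M; exact: compact_support_derive1.
have vv'' : \int[mu]_x (v x * derive1 psi x) = - \int[mu]_x (v' x * psi x).
  by rewrite /Rintegral (vv' _ tpsi) fineN.
by apply: oppr_inj; rewrite -ibp -vv''; exact: wv.
Qed.

(** The classical form of [sobolev1_infty], in which the later arguments are carried out. *)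
Definition Winf u := smooth u /\ forall n, L1 u^`(n).

Lemma sobolev1_infty_Winf u : sobolev1_infty u <-> Winf u.
Proof.
split=> -[su hu]; split => //.
  by move=> n; apply: (smooth_sobolev1_L1 su _ (hu n)).
move=> k; elim: k u su hu => [|k IH] u su hu; first by split => //; exact: (hu 0).
split; first exact: (hu 0).
exists u^`(); split; last first.
  apply: IH; first exact: smooth_derive1.
  by move=> n; rewrite -derive1Sn; exact: (hu n.+1).
move=> psi /(test_function_by_parts su)[i1 i2 h].
by rewrite (L1_EFin i1) (L1_EFin i2) h EFinN.
Qed.

End smooth_functions.

(** * Stability properties of W^{infty,1} *)

Section Winf_algebra.
Context {R : realType}.
Local Notation mu := (@lebesgue_measure R).
Local Notation L1 u := (mu.-integrable setT (EFin \o u)).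
Implicit Types u v f : R -> R.

Lemma Winf_derive1n (C : set (R -> R)) :
  (forall u, C u -> L1 u /\
    exists2 v, C v & forall x : R, is_derive x (1 : R) u (v x)) ->
  forall u, C u -> Winf u.
Proof.
move=> HC u Cu.
have [su Cun] := smooth_derive1n (fun v Cv => (HC v Cv).2) Cu.
by split => // n; exact: (HC _ (Cun n)).1.
Qed.

Lemma Winf_derivable u : Winf u -> forall x, derivable u x 1.
Proof. by move=> [su _]; exact: smooth_derivable. Qed.

Lemma Winf_is_derive u x : Winf u -> is_derive x (1 : R) u (u^`() x).
Proof. by move=> wu; exact/derivable_is_derive/Winf_derivable. Qed.

Lemma Winf_derive1 u : Winf u -> Winf u^`().
Proof.
by move=> [su u1]; split; [exact: smooth_derive1|move=> n; rewrite -derive1Sn].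
Qed.

Lemma Winf_L1 u : Winf u -> L1 u.
Proof. by move=> [_ /(_ 0)]. Qed.

Lemma Winf_continuous u : Winf u -> continuous u.
Proof. by move=> [su _]; exact: smooth_continuous. Qed.

Lemma Winf_measurable u : Winf u -> measurable_fun setT u.
Proof. by move=> wu; apply: continuous_measurable_fun; exact: Winf_continuous. Qed.

Lemma Winf_le u x : Winf u -> `|u x| <= \int[mu]_y `|derive1 u y|.
Proof.
move=> wu; apply: bounded_by_derivative.
- exact: Winf_derivable.
- exact/Winf_continuous/Winf_derive1.
- exact/Winf_L1/Winf_derive1.
- exact: Winf_L1.
Qed.

Lemma Winf_bounded u : Winf u -> exists2 C : R, 0 <= C & forall x, `|u x| <= C.
Proof.
move=> wu; exists (\int[mu]_y `|derive1 u y|); first exact: Rintegral_ge0.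
by move=> x; exact: Winf_le.
Qed.

Lemma Winf_cvg0 u : Winf u -> u x @[x --> -oo] --> 0 /\ u x @[x --> +oo] --> 0.
Proof.
move=> wu; apply: L1_cvg0.
- exact: Winf_derivable.
- exact/Winf_continuous/Winf_derive1.
- exact/Winf_L1/Winf_derive1.
- exact: Winf_L1.
Qed.

Lemma WinfZ (c : R) u : Winf u -> Winf (fun x => c * u x).
Proof.
pose C := [set (fun x => c * u x) | u in @Winf R].
move=> wu; apply: (@Winf_derive1n C); last by exists u.
move=> _ [{}u {}wu <-]; split; first exact/L1Zl/Winf_L1.
exists (fun x => c * derive1 u x); first by exists u^`() => //; exact: Winf_derive1.
by move=> x; have := is_deriveZ c (Winf_is_derive x wu).
Qed.

Lemma WinfD u v : Winf u -> Winf v -> Winf (fun x => u x + v x).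
Proof.
pose C := [set w : R -> R | exists u v, [/\ Winf u, Winf v & w = fun x => u x + v x]].
move=> wu wv; apply: (@Winf_derive1n C); last by exists u, v.
move=> _ [{}u [{}v [{}wu {}wv ->]]]; split; first by apply: L1D; exact: Winf_L1.
exists (fun x => derive1 u x + derive1 v x).
  by exists u^`(), v^`(); split => //; exact: Winf_derive1.
by move=> x; apply: is_deriveD; exact: Winf_is_derive.
Qed.

(** The Leibniz rule turns one product into a sum of two, so the class stable under derivation is
    the span of the products. *)
Inductive bilinear_span : set (R -> R) :=
| bilinear_spanM u v of Winf u & Winf v : bilinear_span (fun x => u x * v x)
| bilinear_spanD u v of bilinear_span u & bilinear_span v :
    bilinear_span (fun x => u x + v x).

Lemma Winf_is_deriveM u v x : Winf u -> Winf v ->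
  is_derive x (1 : R) (fun x => u x * v x) (derive1 u x * v x + u x * derive1 v x).
Proof.
move=> wu wv; have := is_deriveM (Winf_is_derive x wu) (Winf_is_derive x wv).
by apply: eq_is_derive => //; rewrite /GRing.scale/= addrC mulrC.
Qed.

Lemma WinfM u v : Winf u -> Winf v -> Winf (fun x => u x * v x).
Proof.
move=> wu wv; apply: (@Winf_derive1n bilinear_span); last exact: bilinear_spanM.
move=> f; elim=> {f u v wu wv} [u v wu wv|u v _ [u1 [u' Bu' uu']] _ [v1 [v' Bv' vv']]].
  split.
    have [C _ vC] := Winf_bounded wv.
    by apply: (L1_bounded_mul (Winf_measurable wv) vC); exact: Winf_L1.
  exists (fun x => derive1 u x * v x + u x * derive1 v x).
    by apply: bilinear_spanD; apply: bilinear_spanM => //; exact: Winf_derive1.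
  by move=> x; exact: Winf_is_deriveM.
split; first exact: L1D.
exists (fun x => u' x + v' x); first exact: bilinear_spanD.
by move=> x; exact: is_deriveD.
Qed.

End Winf_algebra.

(** * The segment in L^r as a path of diffeomorphisms *)

Section mean_value.
Context {R : realType}.
Implicit Types (f df : R -> R) (a b s t x M : R).

Lemma MVT_le f df a b s t M : a <= s <= b -> a <= t <= b ->
  (forall x, a <= x <= b -> is_derive x (1 : R) f (df x)) ->
  (forall x, a <= x <= b -> `|df x| <= M) -> `|f s - f t| <= M * `|s - t|.
Proof.
move=> s01 t01 fdf dfM; wlog st : s t s01 t01 / t <= s => [wlg|].
  by case: (leP t s) => [/wlg|/ltW/wlg]; [exact|rewrite distrC (distrC s)]; exact.
have ts01 x : t <= x <= s -> a <= x <= b by lra.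
have [||c] := @MVT_segment R f df t s st.
- by move=> x /[!in_itv]/= x_; apply/fdf/ts01; lra.
- apply: derivable_within_continuous => x /[!in_itv]/= x_.
  by have [] := fdf _ (ts01 _ x_).
rewrite in_itv/= => /ts01 c01 ->; rewrite normrM.
by apply: ler_wpM2r => //; exact: dfM.
Qed.

Lemma taylor_le f df a b s t M : a <= s <= b -> a <= t <= b -> 0 <= M ->
  (forall x, a <= x <= b -> is_derive x (1 : R) f (df x)) ->
  (forall x, a <= x <= b -> `|df x - df t| <= M * `|x - t|) ->
  `|f s - f t - (s - t) * df t| <= M * `|s - t| * `|s - t|.
Proof.
move=> sab tab M0 fdf dfM.
(* The mean value inequality for [f x - df t * x] is used only between s and t, where
   [|x - t| <= |s - t|]; [c, d] is this segment, in either order of its ends. *)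
have bnd c d : a <= c -> d <= b -> (forall x, c <= x <= d -> `|x - t| <= `|s - t|) ->
    c <= s <= d -> c <= t <= d ->
    `|f s - f t - (s - t) * df t| <= M * `|s - t| * `|s - t|.
  move=> ac db cd scd tcd.
  have -> : f s - f t - (s - t) * df t = (f s - df t * s) - (f t - df t * t) by ring.
  apply: (@MVT_le (fun x => f x - df t * x) (fun x => df x - df t) c d) => // x xcd.
    have xab : a <= x <= b by lra.
    have := is_deriveB (fdf x xab) (is_deriveZ (df t) (is_derive_id x (1 : R))).
    by apply: eq_is_derive => //; rewrite /GRing.scale/= mulr1.
  by apply: (le_trans (dfM x _)); [lra|rewrite ler_wpM2l// cd].
have [st|st] := leP s t.
  by apply: (bnd s t); try lra; move=> x xst; rewrite !ler0_norm; lra.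
by apply: (bnd t s); try lra; move=> x xst; rewrite !ger0_norm; lra.
Qed.

End mean_value.

(** * Powers of the affine family 1 + t g and their derivatives in t and x *)

Section power_families.
Context {R : realType}.
Local Notation mu := (@lebesgue_measure R).
Local Notation L1 u := (mu.-integrable setT (EFin \o u)).
Variables (g : R -> R) (m : R).
Hypotheses (wg : Winf g) (m0 : 0 < m) (m1 : m <= 1) (mg : forall x, m <= 1 + g x).
Implicit Types (u : R -> R) (H K : R -> R -> R) (b s t x : R).

Local Notation w t x := (1 + t * g x).

(** [1 + t g] is a convex combination of 1 and [1 + g], both at least m. *)
Lemma affine_ge t x : 0 <= t <= 1 -> m <= w t x.
Proof.
move=> /andP[t0 t1].
have : 0 <= t * (1 + g x - m) by rewrite mulr_ge0// subr_ge0.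
have : 0 <= (1 - t) * (1 - m) by rewrite mulr_ge0// subr_ge0.
lra.
Qed.

Lemma affine_gt0 t x : 0 <= t <= 1 -> 0 < w t x.
Proof. by move=> t01; exact: lt_le_trans (affine_ge x t01). Qed.

(** A power is monotone in one direction or the other according to the sign of b; the sum of the two
    end values covers both cases. *)
Lemma powR_le_itv (a M x b : R) : 0 < a -> a <= x -> x <= M -> x `^ b <= a `^ b + M `^ b.
Proof.
move=> a0 ax xM; have x0 := lt_le_trans a0 ax.
have [b0|b0] := leP 0 b.
  by rewrite ler_wpDl ?powR_ge0// ge0_ler_powR// nnegrE ltW// (lt_le_trans x0).
rewrite ler_wpDr ?powR_ge0// -[b]opprK powRN [leRHS]powRN lef_pV2 ?posrE ?powR_gt0//.
by rewrite ge0_ler_powR// ?nnegrE ?oppr_ge0 ltW.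
Qed.

Lemma affine_powR_bounded b : exists2 C : R, 0 <= C &
  forall t x, 0 <= t <= 1 -> `|w t x `^ b| <= C.
Proof.
have [C C0 gC] := Winf_bounded wg.
exists (m `^ b + (1 + C) `^ b); first by rewrite addr_ge0 ?powR_ge0.
move=> t x t01; rewrite ger0_norm ?powR_ge0//; apply: powR_le_itv => //; first exact: affine_ge.
rewrite lerD2l; case/andP: t01 => t0 t1.
apply: (le_trans (ler_norm _)); rewrite normrM (ger0_norm t0).
by rewrite (le_trans _ (gC x))// ler_piMl.
Qed.

Lemma affine_powR_is_derive_t b t x : 0 <= t <= 1 ->
  is_derive t (1 : R) (fun t => w t x `^ b) (b * w t x `^ (b - 1) * g x).
Proof.
move=> t01; have dw : is_derive t (1 : R) (fun t => w t x) (g x).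
  have := is_deriveD (is_derive_cst (1 : R) t (1 : R))
    (is_deriveM (is_derive_id t (1 : R)) (is_derive_cst (g x) t (1 : R))).
  by apply: eq_is_derive => //; rewrite /GRing.scale/= mulr0 mulr1 !add0r.
have := @is_derive1_comp R (fun z => z `^ b) (fun t => w t x) t _ _
  (is_derive1_powR b (affine_gt0 x t01)) dw.
by apply: eq_is_derive.
Qed.

Lemma affine_powR_is_derive_x b t x : 0 <= t <= 1 ->
  is_derive x (1 : R) (fun x => w t x `^ b) (b * w t x `^ (b - 1) * (t * derive1 g x)).
Proof.
move=> t01; have dw : is_derive x (1 : R) (fun x => w t x) (t * derive1 g x).
  have := is_deriveD (is_derive_cst (1 : R) x (1 : R)) (is_deriveZ t (Winf_is_derive x wg)).
  by apply: eq_is_derive => //; rewrite add0r.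
have := @is_derive1_comp R (fun z => z `^ b) (fun x => w t x) x _ _
  (is_derive1_powR b (affine_gt0 x t01)) dw.
by apply: eq_is_derive.
Qed.

(** The factor [t ^+ n] comes from derivation in x: each derivative of [1 + t g] brings out
    [t g']. *)
Definition power_term (n : nat) (b : R) u : R -> R -> R :=
  fun t x => t ^+ n * (w t x `^ b * u x).

(* [jet H K] asserts that H is a sum of terms t^n (1 + t g)^b u, or (1 + t g)^b - 1, with
   time derivative K.  Spatial derivation preserves the class of jets: this is where the
   commutation of the two derivations is verified. *)
Inductive jet : (R -> R -> R) -> (R -> R -> R) -> Prop :=
| jet_term n b u of Winf u : jet (power_term n b u)
    (fun t x => power_term n (b - 1) (fun x => b * g x * u x) t x +
                power_term n.-1 b (fun x => n%:R * u x) t x)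
| jet_powR b : jet (fun t x => w t x `^ b - 1) (power_term 0 (b - 1) (fun x => b * g x))
| jetD H1 K1 H2 K2 of jet H1 K1 & jet H2 K2 :
    jet (fun t x => H1 t x + H2 t x) (fun t x => K1 t x + K2 t x).

Lemma jet_is_derive_t H K t x : jet H K -> 0 <= t <= 1 ->
  is_derive t (1 : R) (fun t => H t x) (K t x).
Proof.
move=> HK t01; elim: HK => [n b u wu|b|H1 K1 H2 K2 _ IH1 _ IH2].
- have := is_deriveM (is_deriveX n (is_derive_id t (1 : R)))
    (is_deriveM (affine_powR_is_derive_t b x t01) (is_derive_cst (u x) t (1 : R))).
  apply: eq_is_derive => [z|]; first by rewrite !fctE.
  (* For n = 0 the term with exponent [n.-1] has coefficient 0. *)
  rewrite !fctE /GRing.scale/= /power_term; case: n => [|n]; rewrite ?expr0/= !mulr0 ?mul0r; ring.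
- have := is_deriveB (affine_powR_is_derive_t b x t01) (is_derive_cst (1 : R) t (1 : R)).
  by apply: eq_is_derive => //; rewrite /power_term expr0; ring.
- exact: is_deriveD.
Qed.

Lemma jet_dt H K : jet H K -> exists L, jet K L.
Proof.
elim => [n b u wu|b|H1 K1 H2 K2 _ [L1 ?] _ [L2 ?]].
- eexists; apply: jetD; apply: jet_term; last exact: WinfZ.
  by apply: WinfM => //; exact: WinfZ.
- eexists; apply: jet_term; exact: WinfZ.
- by eexists; apply: jetD; eassumption.
Qed.

Lemma power_term_is_derive_x n b u t x : Winf u -> 0 <= t <= 1 ->
  is_derive x (1 : R) (power_term n b u t)
    (power_term n.+1 (b - 1) (fun x => b * derive1 g x * u x) t x +
     power_term n b u^`() t x).
Proof.
move=> wu t01.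
have := is_deriveZ (t ^+ n) (is_deriveM (affine_powR_is_derive_x b x t01) (Winf_is_derive x wu)).
apply: eq_is_derive => //; rewrite /GRing.scale/= /power_term exprS; ring.
Qed.

(** Kx is at once the time derivative of Hx, by [jet Hx Kx], and the space derivative of K. *)
Lemma jet_dx H K : jet H K -> exists Hx Kx, jet Hx Kx /\
  forall t x, 0 <= t <= 1 ->
    is_derive x (1 : R) (H t) (Hx t x) /\ is_derive x (1 : R) (K t) (Kx t x).
Proof.
have wg' := Winf_derive1 wg.
elim => [n b u wu|b|H1 K1 H2 K2 _ [Hx1 [Kx1 [J1 D1]]] _ [Hx2 [Kx2 [J2 D2]]]].
- have wu1 : Winf (fun x => b * derive1 g x * u x).
    by apply: WinfM => //; exact: WinfZ.
  do 2 eexists; split.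
    by apply: jetD; [exact: (jet_term n.+1 (b - 1) wu1)|
                     exact: (jet_term n b (Winf_derive1 wu))].
  move=> t x t01; split; first exact: power_term_is_derive_x.
  have wu2 : Winf (fun x => b * g x * u x) by apply: WinfM => //; exact: WinfZ.
  have wu3 : Winf (fun x => n%:R * u x) by exact: WinfZ.
  have := is_deriveD (power_term_is_derive_x n (b - 1) x wu2 t01)
                     (power_term_is_derive_x n.-1 b x wu3 t01).
  apply: eq_is_derive => //.
  have d2 : derive1 (fun x => b * g x * u x) x =
      b * derive1 g x * u x + b * g x * derive1 u x.
    apply: is_derive_derive1.
    have := is_deriveM (is_deriveZ b (Winf_is_derive x wg)) (Winf_is_derive x wu).
    apply: eq_is_derive; first by move=> z; rewrite !fctE.
    by rewrite -[LHS]/(b * g x * derive1 u x + u x * (b * derive1 g x)); ring.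
  have d3 : derive1 (fun x => n%:R * u x) x = n%:R * derive1 u x.
    by apply: is_derive_derive1; exact: (is_deriveZ n%:R (Winf_is_derive x wu)).
  (* The coefficient n + 1 of [b g' u] on one side arises as 1 + n on the other. The power [n.-1.+1]
     equals n only for n > 0; for n = 0 its coefficient is 0. *)
  rewrite /power_term d2 d3; case: (n) => [|k]; rewrite ?expr0 ?exprS/=; last first.
    by rewrite -[k.+1%:R]natr1 -[k.+2%:R]natr1 -[k.+1%:R]natr1; ring.
  by ring.
- have wu1 : Winf (fun x => b * derive1 g x) by exact: WinfZ.
  do 2 eexists; split; first exact: (jet_term 1 (b - 1) wu1).
  move=> t x t01; split.
    have := is_deriveB (affine_powR_is_derive_x b x t01) (is_derive_cst (1 : R) x (1 : R)).
    by apply: eq_is_derive => //; rewrite /power_term expr1; ring.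
  have wu2 : Winf (fun x => b * g x) by exact: WinfZ.
  have := power_term_is_derive_x 0 (b - 1) x wu2 t01.
  apply: eq_is_derive => //.
  have d2 : derive1 (fun x => b * g x) x = b * derive1 g x.
    by apply: is_derive_derive1; exact: (is_deriveZ b (Winf_is_derive x wg)).
  by rewrite /power_term d2 expr0 !expr1 mul1r/=; ring.
- do 2 eexists; split; first exact: (jetD J1 J2).
  move=> t x t01; have [D1H D1K] := D1 t x t01; have [D2H D2K] := D2 t x t01.
  by split; exact: is_deriveD.
Qed.

Lemma jet_continuous H K t : jet H K -> 0 <= t <= 1 -> continuous (H t).
Proof.
move=> /jet_dx[Hx [Kx [_ D]]] t01; apply: derivable_continuous => x.
by have [[]] := D t x t01.
Qed.

Lemma jet_bound H K : jet H K -> exists2 U : R -> R, L1 U &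
  forall t x, 0 <= t <= 1 -> `|H t x| <= U x.
Proof.
have term n b u : Winf u -> exists2 U : R -> R, L1 U &
    forall t x, 0 <= t <= 1 -> `|power_term n b u t x| <= U x.
  move=> wu; have [C C0 wC] := affine_powR_bounded b.
  exists (fun x => C * `|u x|); first exact/L1Zl/L1_norm/Winf_L1.
  move=> t x /andP[t0 t1]; rewrite /power_term normrM normrX (ger0_norm t0).
  rewrite normrM -[leRHS]mul1r ler_pM ?exprn_ge0 ?exprn_ile1//.
  by rewrite ler_wpM2r// wC// t0.
elim => [n b u wu|b|H1 K1 H2 K2 _ [U1 i1 HU1] _ [U2 i2 HU2]].
- exact: term.
(* [(1 + t g)^b - 1] vanishes at t = 0, so it is bounded by its time derivative, a single power term
   with an integrable bound. *)
- have [U iU HU] := term 0 (b - 1) _ (WinfZ b wg); exists U => // t x t01.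
  have z01 : (0 : R) <= (0 : R) <= 1 by rewrite lexx/= ler01.
  have := @MVT_le _ (fun t => w t x `^ b - 1) (fun t => power_term 0 (b - 1) (fun x => b * g x) t x)
    0 1 t 0 (U x) t01 z01.
  have -> : w 0 x = 1 by rewrite mul0r addr0.
  rewrite powR1 subrr !subr0 => h.
  apply: (le_trans (h _ _)) => //.
  + by move=> s s01; exact: (jet_is_derive_t x (jet_powR b) s01).
  + by move=> s s01; exact: HU.
  + case/andP: t01 => t0 t1; rewrite ger0_norm// ler_piMr//.
    by rewrite (le_trans _ (HU 0 x z01)).
- exists (fun x => U1 x + U2 x); first exact: L1D.
  by move=> t x t01; rewrite (le_trans (ler_normD _ _))// lerD ?HU1 ?HU2.
Qed.

Lemma jet_L1 H K t : jet H K -> 0 <= t <= 1 -> L1 (H t).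
Proof.
move=> J t01; have [U iU HU] := jet_bound J.
apply: (L1_le _ _ iU) => [|x]; last exact: HU.
by apply: continuous_measurable_fun; exact: jet_continuous J t01.
Qed.

Lemma jet_Winf H K t : jet H K -> 0 <= t <= 1 -> Winf (H t).
Proof.
move=> J t01; pose C := [set f | exists H K, jet H K /\ f = H t].
apply: (@Winf_derive1n _ C); last by exists H, K.
move=> _ [{}H [{}K [{}J ->]]]; split; first exact: jet_L1 J t01.
have [Hx [Kx [Jx D]]] := jet_dx J; exists (Hx t); first by exists Hx, Kx.
by move=> x; have [] := D t x t01.
Qed.

Lemma jet_lipschitz H K : jet H K -> exists2 U : R -> R, L1 U &
  forall s t x, 0 <= s <= 1 -> 0 <= t <= 1 -> `|H s x - H t x| <= U x * `|s - t|.
Proof.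
move=> J; have [L JL] := jet_dt J; have [U iU HU] := jet_bound JL; exists U => // s t x s01 t01.
apply: (@MVT_le _ (fun t => H t x) (fun t => K t x) 0 1) => // y y01.
  exact: jet_is_derive_t.
exact: HU.
Qed.

(** K is itself a jet, hence Lipschitz in time with an integrable constant. The bound is pointwise
    in x so that it can be integrated. *)
Lemma jet_taylor H K : jet H K -> exists2 U : R -> R, L1 U &
  forall s t x, 0 <= s <= 1 -> 0 <= t <= 1 -> s != t ->
    `|(s - t)^-1 * (H s x - H t x) - K t x| <= U x * `|s - t|.
Proof.
move=> J; have [L JL] := jet_dt J; have [U iU HU] := jet_lipschitz JL.
exists U => // s t x s01 t01 st.
have st0 : `|s - t| > 0 by rewrite normr_gt0 subr_eq0.
have U0 : 0 <= U x.
  by rewrite -(pmulr_lge0 _ st0); apply: le_trans (HU s t x s01 t01); exact: normr_ge0.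
have := @taylor_le _ (fun t => H t x) (fun t => K t x) 0 1 s t (U x) s01 t01 U0.
move=> h; rewrite -(ler_pM2l st0) -normrM mulrBr mulrA divff ?subr_eq0// mul1r.
rewrite [leRHS]mulrC; apply: h => y y01; first exact: jet_is_derive_t.
exact: HU.
Qed.

End power_families.

Section limits.
Context {R : realType}.
Implicit Types (a b t s C : R).

(** Properness makes the limit that defines [velocity] unique, also at the end points. *)
Lemma within_dnbhs_proper a b t : a < b -> t \in `[a, b]%R ->
  ProperFilter (within `[a, b] t^').
Proof.
move=> ab /[!in_itv]/= /andP[ta tb]; apply: Build_ProperFilter_ex => P.
rewrite /within/= => -[e /= e0 eP].
pose d := Num.min (e / 2) ((b - a) / 2).
have d0 : 0 < d by rewrite lt_min !divr_gt0// subr_gt0.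
have de : d <= e / 2 by rewrite ge_min lexx.
have dab : d <= (b - a) / 2 by rewrite ge_min lexx orbT.
(* From the left half of [a, b] one moves right, otherwise left: a length (b - a) / 2 is available
   in both cases. *)
have [tm|tm] := leP t ((a + b) / 2).
  exists (t + d); apply: eP => /=.
  - by rewrite opprD addrA subrr sub0r normrN gtr0_norm//; lra.
  - by rewrite gt_eqF// ltrDl.
  - by rewrite in_itv/=; apply/andP; split; lra.
exists (t - d); apply: eP => /=.
- by rewrite opprB addrC subrK gtr0_norm//; lra.
- by rewrite lt_eqF// gtrBl.
- by rewrite in_itv/=; apply/andP; split; lra.
Qed.

Lemma within_nbhs_sub a b t (P : R -> Prop) : (\forall s \near t, P s) ->
  (\forall s \near within `[a, b] t^', P s) /\ (\forall s \near within `[a, b] (nbhs t), P s).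
Proof.
move=> nP; split; rewrite near_withinE; last by apply: filterS nP.
by rewrite /dnbhs near_withinE; apply: filterS nP.
Qed.

Lemma squeeze_lipschitz (F : set_system R) {FF : Filter F} (f : R -> R) l C t :
  (forall e, 0 < e -> \forall s \near F, `|s - t| < e) ->
  (\forall s \near F, `|f s - l| <= C * `|s - t|) -> f s @[s --> F] --> l.
Proof.
move=> Ft fl; apply/cvgrPdist_le => e e0; near=> s.
rewrite distrC; apply: (@le_trans _ _ (C * `|s - t|)); first by near: s.
apply: (@le_trans _ _ ((`|C| + 1) * `|s - t|)).
  by rewrite ler_wpM2r// ler_wpDr// ler_norm.
rewrite mulrC -ler_pdivlMr ?ltr_wpDl// ltW//.
by near: s; apply: Ft; rewrite divr_gt0// ltr_wpDl.
Unshelve. all: by end_near. Qed.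

Lemma squeeze_lipschitze (F : set_system R) {FF : Filter F} (f : R -> \bar R) C t :
  (forall e, 0 < e -> \forall s \near F, `|s - t| < e) ->
  (\forall s \near F, (0 <= f s <= (C * `|s - t|)%:E)%E) -> f s @[s --> F] --> 0%E.
Proof.
move=> Ft fl; apply: (@squeeze_cvge _ _ _ _ (fun=> 0%E) _ (fun s => (C * `|s - t|)%:E)) => //.
  exact: cvg_cst.
apply: cvg_EFin; first exact: nearW.
apply: (@squeeze_lipschitz _ _ _ _ `|C| t) => //; apply: nearW => s.
by rewrite subr0 normrM normr_id.
Qed.

Lemma within_dnbhs_lt a b t e : 0 < e -> \forall s \near within `[a, b] t^', `|s - t| < e.
Proof.
move=> e0; apply: (within_nbhs_sub a b _).1.
by exists e => //= s; rewrite distrC.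
Qed.

Lemma within_nbhs_lt a b t e : 0 < e ->
  \forall s \near within `[a, b] (nbhs t), `|s - t| < e.
Proof.
move=> e0; apply: (within_nbhs_sub a b _).2.
by exists e => //= s; rewrite distrC.
Qed.

End limits.

Section norms.
Context {R : realType}.
Local Notation mu := (@lebesgue_measure R).
Local Notation L1 u := (mu.-integrable setT (EFin \o u)).
Implicit Types (u U : R -> R) (H K : R -> R -> R) (s t : R).

Lemma sobolev1_norm0 u : sobolev1_norm 0 u = (\int[mu]_x `|u x|%:E)%E.
Proof. by rewrite /sobolev1_norm big_ord_recl big_ord0 adde0. Qed.

Lemma sobolev1_normS k u :
  sobolev1_norm k.+1 u = (\int[mu]_x `|u x|%:E + sobolev1_norm k u^`())%E.
Proof.
rewrite /sobolev1_norm big_ord_recl; congr (_ + _)%E.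
by apply: eq_bigr => i _; rewrite derive1Sn.
Qed.

Lemma sobolev1_norm_ge0 k u : (0 <= sobolev1_norm k u)%E.
Proof. by apply: sume_ge0 => i _; apply: integral_ge0 => x _; rewrite lee_fin. Qed.

Lemma integral_norm_le u U c : measurable_fun setT u -> L1 U ->
  (forall x, `|u x| <= U x * c) ->
  (\int[mu]_x `|u x|%:E <= ((\int[mu]_x U x) * c)%:E)%E.
Proof.
move=> mu_ iU uU.
have iUc : L1 (fun x => U x * c) by under eq_fun do rewrite mulrC; exact: L1Zl.
have -> : (\int[mu]_x U x) * c = \int[mu]_x (U x * c).
  by rewrite -RintegralZr.
rewrite -L1_EFin//; apply: ge0_le_integral => //=.
- exact/measurable_EFinP/measurableT_comp.
- exact: measurable_int iUc.
- by move=> x _; rewrite lee_fin.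
Qed.

Variables (g : R -> R) (m : R).
Hypotheses (wg : Winf g) (m0 : 0 < m) (m1 : m <= 1) (mg : forall x, m <= 1 + g x).

(** Induction on k: by [jet_dx], derivation in x sends the defect of the difference quotient of (H,
    K) to that of (Hx, Kx). *)
Lemma jet_quotient_norm k H K : jet g H K -> exists C : R, forall s t,
  0 <= s <= 1 -> 0 <= t <= 1 -> s != t ->
  (sobolev1_norm k (fun x => (s - t)^-1 * (H s x - H t x) - K t x)%R <= (C * `|s - t|)%:E)%E.
Proof.
elim: k H K => [|k IH] H K J; have [U iU HU] := jet_taylor wg m0 m1 mg J.
all: have D0 s t : 0 <= s <= 1 -> 0 <= t <= 1 -> s != t ->
    (\int[mu]_x `|(s - t)^-1 * (H s x - H t x) - K t x|%R%:E <= ((\int[mu]_x U x) * `|s - t|)%:E)%E.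
1,3: move=> s01 t01 st; apply: integral_norm_le => //; last by move=> x; exact: HU.
1,2: have [L JK] := jet_dt wg J; apply: continuous_measurable_fun => x;
     apply: cvgB; [apply: cvgM; [exact: cvg_cst|apply: cvgB]|];
     by [exact: (jet_continuous wg m0 m1 mg J)|exact: (jet_continuous wg m0 m1 mg JK)].
  by exists (\int[mu]_x U x) => s t s01 t01 st; rewrite sobolev1_norm0; exact: D0.
have [Hx [Kx [Jx D]]] := jet_dx wg m0 m1 mg J; have [C HC] := IH _ _ Jx.
exists (\int[mu]_x U x + C) => s t s01 t01 st; rewrite sobolev1_normS mulrDl EFinD.
apply: leeD; first exact: D0.
rewrite (_ : derive1 _ = fun x => (s - t)^-1 * (Hx s x - Hx t x) - Kx t x); first exact: HC.
apply/funext => x; apply: is_derive_derive1.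
have [DHs _] := D s x s01; have [DHt DKt] := D t x t01.
exact: is_deriveB (is_deriveZ (s - t)^-1 (is_deriveB DHs DHt)) DKt.
Qed.

Lemma jet_difference_norm k H K : jet g H K -> exists C : R, forall s t,
  0 <= s <= 1 -> 0 <= t <= 1 ->
  (sobolev1_norm k (fun x => H s x - H t x)%R <= (C * `|s - t|)%:E)%E.
Proof.
elim: k H K => [|k IH] H K J; have [U iU HU] := jet_lipschitz wg m0 m1 mg J.
all: have D0 s t : 0 <= s <= 1 -> 0 <= t <= 1 ->
    (\int[mu]_x `|H s x - H t x|%R%:E <= ((\int[mu]_x U x) * `|s - t|)%:E)%E.
1,3: move=> s01 t01; apply: integral_norm_le => //; last by move=> x; exact: HU.
1,2: apply: continuous_measurable_fun => x;
     by apply: cvgB; exact: (jet_continuous wg m0 m1 mg J).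
  by exists (\int[mu]_x U x) => s t s01 t01; rewrite sobolev1_norm0; exact: D0.
have [Hx [Kx [Jx D]]] := jet_dx wg m0 m1 mg J; have [C HC] := IH _ _ Jx.
exists (\int[mu]_x U x + C) => s t s01 t01; rewrite sobolev1_normS mulrDl EFinD.
apply: leeD; first exact: D0.
rewrite (_ : derive1 _ = fun x => Hx s x - Hx t x); first exact: HC.
apply/funext => x; apply: is_derive_derive1.
by have [DHs _] := D s x s01; have [DHt _] := D t x t01; exact: is_deriveB.
Qed.

End norms.

(** * The path with image a segment is a C^1 curve of diffeomorphisms *)

Section linear_path.
Context {R : realType}.
Local Notation mu := (@lebesgue_measure R).
Local Notation L1 u := (mu.-integrable setT (EFin \o u)).
Implicit Types (u U : R -> R) (H K : R -> R -> R) (s t x a b : R).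

(** The identity is split off because it is [(1 + t g)^r - 1] that is integrable on the line. *)
Definition linear_path (g : R -> R) (r t x : R) : R :=
  x + primitive (fun x => (1 + t * g x) `^ r - 1) x.

Variables (g : R -> R) (m r : R).
Hypotheses (wg : Winf g) (m0 : 0 < m) (m1 : m <= 1) (mg : forall x, m <= 1 + g x).

Let H t x := (1 + t * g x) `^ r - 1.
Let K := power_term g 0 (r - 1) (fun x => r * g x).
Let J : jet g H K := jet_powR g r.
Let p := linear_path g r.

Let Hc t : 0 <= t <= 1 -> continuous (H t).
Proof. exact: (jet_continuous wg m0 m1 mg J). Qed.

Let H1 t : 0 <= t <= 1 -> L1 (H t).
Proof. exact: (jet_L1 wg m0 m1 mg J). Qed.

Let KW t : 0 <= t <= 1 -> Winf (K t).
Proof. by have [L JK] := jet_dt wg J; exact: (jet_Winf wg m0 m1 mg JK). Qed.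

Let pE t : (fun x => p t x - x) = primitive (H t).
Proof. by apply/funext => x; rewrite /p /linear_path addrC addKr. Qed.

Lemma linear_path_is_derive t x : 0 <= t <= 1 ->
  is_derive x (1 : R) (linear_path g r t) ((1 + t * g x) `^ r).
Proof.
move=> t01; have := is_deriveD (is_derive_id x (1 : R)) (primitive_is_derive x (Hc t01) (H1 t01)).
by apply: eq_is_derive => //; rewrite /H addrC subrK.
Qed.

Lemma linear_path_Diff t : 0 <= t <= 1 -> Diff (linear_path g r t).
Proof.
move=> t01; rewrite /Diff/= -/p pE.
have dE : (primitive (H t))^`() = H t.
  by apply/funext => x; apply: is_derive_derive1; exact: primitive_is_derive (Hc t01) (H1 t01).
rewrite dE; split.
- by move=> x; case: (primitive_is_derive x (Hc t01) (H1 t01)).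
- exact/sobolev1_infty_Winf/(jet_Winf wg m0 m1 mg J).
- by move=> x; rewrite /H ltrDr powR_gt0// (affine_gt0 m0 m1 mg).
- exact: primitive_cvg0 (H1 t01).
Qed.

Let primK_is_derive t x : 0 <= t <= 1 -> is_derive x (1 : R) (primitive (K t)) (K t x).
Proof.
by move=> t01; apply: primitive_is_derive; [exact/Winf_continuous/KW|exact/Winf_L1/KW].
Qed.

Let quotient_is_derive s t x : 0 <= s <= 1 -> 0 <= t <= 1 ->
  is_derive x (1 : R) (diff_quot p t s \- primitive (K t))
    ((s - t)^-1 * (H s x - H t x) - K t x).
Proof.
move=> s01 t01.
have := is_deriveB (is_deriveZ (s - t)^-1 (is_deriveB
    (linear_path_is_derive x s01) (linear_path_is_derive x t01)))
  (primK_is_derive x t01).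
apply: eq_is_derive => //; rewrite /H /GRing.scale/=; ring.
Qed.

Let quotient_cvg0 s t : 0 <= s <= 1 -> 0 <= t <= 1 ->
  (diff_quot p t s \- primitive (K t)) x @[x --> -oo] --> 0.
Proof.
move=> s01 t01.
have c1 : primitive (H s) x - primitive (H t) x @[x --> -oo] --> (0 : R) - 0.
  by apply: cvgB; exact/primitive_cvg0/H1.
have -> : (diff_quot p t s \- primitive (K t)) =
    (fun x => (s - t)^-1 * (primitive (H s) x - primitive (H t) x) - primitive (K t) x).
  apply/funext => x; rewrite /diff_quot /= /p /linear_path; congr (_ * _ - _).
  by rewrite opprD addrACA subrr add0r.
have z : 0 = (s - t)^-1 * (0 - 0) - 0 by rewrite !subr0 mulr0.
rewrite [X in _ --> X]z; apply: cvgB; first exact: cvgMl_tmp c1.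
exact: primitive_cvg0 (Winf_L1 (KW t01)).
Qed.

Let itv01 a b t : 0 <= a -> b <= 1 -> t \in `[a, b]%R -> 0 <= t <= 1.
Proof. by move=> a0 b1 /[!in_itv]/=; lra. Qed.

(** [velocity] is a pointwise limit. The defect of the difference quotient vanishes at -oo, so its
    values are bounded by the L^1 norm of its x-derivative, which [jet_quotient_norm] controls with
    k = 0. *)
Lemma linear_path_velocity a b t : 0 <= a -> a < b -> b <= 1 -> t \in `[a, b]%R ->
  velocity a b (linear_path g r) t = primitive (power_term g 0 (r - 1) (fun x => r * g x) t).
Proof.
move=> a0 ab b1 tab; have t01 := itv01 a0 b1 tab.
apply/funext => x; rewrite /velocity -/p -/K.
have FF := within_dnbhs_proper ab tab.
apply/cvg_lim => //.
have [C HC] := jet_quotient_norm wg m0 m1 mg 0 J.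
apply: (@squeeze_lipschitz _ _ _ _ _ C t); first exact: within_dnbhs_lt.
rewrite near_withinE /dnbhs near_withinE; apply: nearW => s /= st /(itv01 a0 b1) s01.
have dc y := @quotient_is_derive s t y s01 t01.
have dE : (diff_quot p t s \- primitive (K t))^`() =
    (fun x => (s - t)^-1 * (H s x - H t x) - K t x).
  by apply/funext => y; exact: is_derive_derive1.
have WD : Winf (fun x => (s - t)^-1 * (H s x - H t x) - K t x).
  have := WinfD (WinfZ (s - t)^-1 (WinfD (jet_Winf wg m0 m1 mg J s01)
    (WinfZ (-1) (jet_Winf wg m0 m1 mg J t01)))) (WinfZ (-1) (KW t01)).
  by under eq_fun do rewrite !mulN1r.
rewrite -lee_fin; apply: le_trans (HC s t s01 t01 st).
rewrite sobolev1_norm0 (L1_EFin (L1_norm (Winf_L1 WD))) lee_fin.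
have := @bounded_by_derivative_cvgNy _ (diff_quot p t s \- primitive (K t)) x.
rewrite dE; apply.
- by move=> y; case: (dc y).
- exact: Winf_continuous.
- exact: Winf_L1.
- exact: quotient_cvg0.
Qed.

Lemma linear_path_is_path a b : 0 <= a -> a < b -> b <= 1 -> is_path a b (linear_path g r).
Proof.
move=> a0 ab b1 t tab; have t01 := itv01 a0 b1 tab; have vE := linear_path_velocity a0 ab b1.
have kE s : 0 <= s <= 1 -> (primitive (K s))^`() = K s.
  by move=> s01; apply/funext => x; apply: is_derive_derive1; exact: primK_is_derive.
split; first exact: linear_path_Diff.
- rewrite vE// /lie_algebra/= -/K kE//; split.
  + by move=> x; case: (primK_is_derive x t01).
  + exact/sobolev1_infty_Winf/KW.
  + exact: primitive_cvg0 (Winf_L1 (KW t01)).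
- move=> k; have [C HC] := jet_quotient_norm wg m0 m1 mg k J.
  apply: (@squeeze_lipschitze _ _ _ _ C t); first exact: within_dnbhs_lt.
  rewrite near_withinE /dnbhs near_withinE; apply: nearW => s /= st /(itv01 a0 b1) s01.
  rewrite /seminorm sobolev1_norm_ge0/= vE//.
  rewrite (_ : derive1 _ = fun x => (s - t)^-1 * (H s x - H t x) - K t x); first exact: HC.
  by apply/funext => x; apply: is_derive_derive1; exact: quotient_is_derive.
- move=> k; have [L JK] := jet_dt wg J.
  have [C HC] := jet_difference_norm wg m0 m1 mg k JK.
  apply: (@squeeze_lipschitze _ _ _ _ C t); first exact: within_nbhs_lt.
  rewrite near_withinE; apply: nearW => s /= sab; have s01 := itv01 a0 b1 sab.
  rewrite /seminorm sobolev1_norm_ge0/= !vE//.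
  rewrite (_ : derive1 _ = fun x => K s x - K t x); first exact: HC.
  by apply/funext => x; apply: is_derive_derive1; apply: is_deriveB; exact: primK_is_derive.
Qed.

End linear_path.

(** * Change of variables *)

Section diffeomorphism.
Context {R : realType}.
Local Notation mu := (@lebesgue_measure R).
Implicit Types (u h phi : R -> R).

(** u tends to 0 at both ends, so 1 + u > 1/2 off a segment, on which u attains a minimum above -1.
    The minimum with 1/2 also ensures m <= 1. *)
Lemma Winf_lower_bound u : Winf u -> (forall x, -1 < u x) ->
  exists m : R, [/\ 0 < m, m <= 1 & forall x, m <= 1 + u x].
Proof.
move=> wu u1; have [/cvgr0Pnorm_lt uN /cvgr0Pnorm_lt uP] := Winf_cvg0 wu.
have h0 : 0 < 2^-1 :> R by rewrite invr_gt0.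
have [A [_ uA]] := uN _ h0; have [B [_ uB]] := uP _ h0.
pose M := `|A| + `|B|.
have M0 : 0 <= M by rewrite addr_ge0.
have [c _ cM] : exists2 c, c \in `[- M, M]%R &
    forall t, t \in `[- M, M]%R -> u c <= u t.
  by apply: EVT_min; [rewrite ge0_cp|exact/continuous_subspaceT/Winf_continuous].
exists (Num.min 2^-1 (1 + u c)); split.
- by rewrite lt_min h0/= -ltrBlDl sub0r.
- by rewrite ge_min invf_le1// ler1n.
- move=> x; rewrite ge_min; have [xM|xM] := leP `|x| M.
    by rewrite lerD2l cM ?orbT// in_itv/= -ler_norml.
  apply/orP; left; suff : `|u x| < 2^-1 by rewrite ltr_norml => /andP[? _]; lra.
  have [x0|x0] := leP 0 x.
    apply: uB; move: xM; rewrite (ger0_norm x0); apply: le_lt_trans.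
    by rewrite (le_trans (ler_norm _))// lerDr.
  apply: uA => /=; move: xM; rewrite (ltr0_norm x0) ltrNr; move/lt_le_trans; apply.
  by rewrite lerNl (le_trans (ler_norm _))// normrN lerDl.
Qed.

Lemma Diff_derive1 phi : Diff phi ->
  [/\ forall x, is_derive x (1 : R) phi (derive1 phi x),
      Winf (fun x => derive1 phi x - 1),
      exists m : R, [/\ 0 < m, m <= 1 & forall x, m <= derive1 phi x]
    & phi x - x @[x --> -oo] --> 0].
Proof.
rewrite /Diff/=; set f := (fun x => phi x - x) => -[df /sobolev1_infty_Winf wf f1 f0].
have dphi (x : R) : is_derive x (1 : R) phi (1 + derive1 f x).
  have := is_deriveD (is_derive_id x (1 : R)) (derivable_is_derive (df x)).
  by apply: eq_is_derive => // y; rewrite /f !fctE addrC subrK.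
have E x : derive1 phi x = 1 + derive1 f x by exact: is_derive_derive1.
split => //.
- by move=> x; rewrite E.
- by under eq_fun do rewrite E addrAC subrr add0r.
- have [m [m0 m1 mf]] := Winf_lower_bound wf f1; exists m; split => // x.
  by rewrite E.
Qed.

Lemma Diff_derive1_gt0 phi x : Diff phi -> 0 < derive1 phi x.
Proof. by move=> /Diff_derive1[_ _ [m [m0 _ mphi]] _]; exact: lt_le_trans (mphi x). Qed.

Lemma Diff_derivable phi x : Diff phi -> derivable phi x 1.
Proof. by move=> /Diff_derive1[dphi _ _ _]; case: (dphi x). Qed.

Lemma Diff_continuous phi : Diff phi -> continuous phi.
Proof. by move=> dphi; apply: derivable_continuous => x; exact: Diff_derivable. Qed.

Lemma Diff_derive1_continuous phi : Diff phi -> continuous (derive1 phi).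
Proof.
move=> /Diff_derive1[_ wphi _ _].
rewrite (_ : derive1 phi = (fun x => (derive1 phi x - 1) + 1)); last first.
  by apply/funext => x; rewrite subrK.
by move=> x; apply: cvgD; [exact: (Winf_continuous wphi)|exact: cvg_cst].
Qed.

(** This linear growth yields monotonicity, surjectivity and the limits at both ends. *)
Lemma Diff_expanding phi : Diff phi -> exists2 m : R, 0 < m &
  forall x y, x <= y -> m * (y - x) <= phi y - phi x.
Proof.
move=> Dphi; have [dphi _ [m [m0 _ mphi]] _] := Diff_derive1 Dphi.
exists m => // x y xy.
have [|c _ ->] := @MVT_segment R phi (derive1 phi) x y xy (fun z _ => dphi z).
  exact/continuous_subspaceT/Diff_continuous.
by rewrite ler_wpM2r// subr_ge0.
Qed.

Lemma Diff_increasing phi : Diff phi -> {homo phi : x y / (x < y)%R}.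
Proof.
move=> /Diff_expanding[m m0 mphi] x y xy; rewrite -subr_gt0.
by apply: lt_le_trans (mphi _ _ (ltW xy)); rewrite mulr_gt0// subr_gt0.
Qed.

Lemma Diff_cvg phi : Diff phi ->
  phi x @[x --> -oo] --> -oo /\ phi x @[x --> +oo] --> +oo.
Proof.
move=> /Diff_expanding[m m0 mphi]; split.
- apply/cvgrNyPle => A; near=> x.
  have x0 : x <= 0 by near: x; exact: nbhs_ninfty_le.
  have xA : x <= (A - phi 0) / m by near: x; apply: nbhs_ninfty_le; rewrite num_real.
  have := mphi _ _ x0; rewrite sub0r mulrN.
  by move: xA; rewrite ler_pdivlMr// mulrC; lra.
- apply/cvgryPge => A; near=> x.
  have x0 : 0 <= x by near: x; exact: nbhs_pinfty_ge.
  have xA : (A - phi 0) / m <= x by near: x; apply: nbhs_pinfty_ge; rewrite num_real.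
  have := mphi _ _ x0; rewrite subr0.
  by move: xA; rewrite ler_pdivrMr// mulrC; lra.
Unshelve. all: by end_near. Qed.

Lemma Diff_injective phi : Diff phi -> injective phi.
Proof.
move=> /Diff_increasing iphi x y xy; apply/eqP; rewrite eq_le !leNgt.
by apply/andP; split; apply/negP => /iphi; rewrite xy ltxx.
Qed.

Lemma Diff_surjective phi (y : R) : Diff phi -> exists x, phi x = y.
Proof.
move=> Dphi; have [m m0 mphi] := Diff_expanding Dphi.
(* Over a length c, phi grows by at least [|y - phi 0|], so its values at -c and c enclose y. *)
pose c := `|y - phi 0| / m.
have c0 : 0 <= c by rewrite divr_ge0// ltW.
have mc : m * c = `|y - phi 0| by rewrite mulrC divfK// gt_eqF.
have [||x _ <-] := @IVT R phi (- c) c y _ (continuous_subspaceT (Diff_continuous Dphi)).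
- by rewrite ge0_cp.
- have := mphi _ _ c0; rewrite subr0 mc => h1.
  have : m * c <= phi 0 - phi (- c).
    by have := mphi (- c) 0; rewrite oppr_le0 c0 sub0r opprK => /(_ isT).
  rewrite mc => h2; have := ler_norm (y - phi 0); have := lerNnormlW (lexx `|y - phi 0|).
  by rewrite ge_min le_max; move=> ? ?; apply/andP; split; apply/orP; [left|right]; lra.
- by exists x.
Qed.

Lemma diff_invK phi : Diff phi -> cancel phi (diff_inv phi).
Proof.
move=> Dphi x; rewrite /diff_inv pinvKV ?inE// => y z _ _; exact: Diff_injective.
Qed.

Lemma diff_invKV phi : Diff phi -> cancel (diff_inv phi) phi.
Proof.
move=> Dphi y; rewrite /diff_inv pinvK//= inE.
by have [x <-] := Diff_surjective y Dphi; exists x.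
Qed.

Lemma diff_inv_is_derive phi (x : R) : Diff phi ->
  is_derive x (1 : R) (diff_inv phi) (derive1 phi (diff_inv phi x))^-1.
Proof.
move=> Dphi; have [dphi _ _ _] := Diff_derive1 Dphi.
pose y := diff_inv phi x.
have := @is_derive_inverse R phi (diff_inv phi) (derive1 phi y) y.
rewrite diff_invKV//; apply.
- by near=> z; exact: diff_invK.
- by near=> z; exact: (Diff_continuous Dphi).
- by rewrite gt_eqF// Diff_derive1_gt0.
Unshelve. all: by end_near. Qed.

Lemma powR_continuous (f : R -> R) b : continuous f -> (forall x, 0 < f x) ->
  continuous (fun x => f x `^ b).
Proof.
move=> cf f0 x; apply: (@continuous_comp _ _ _ f (fun y => y `^ b)); first exact: cf.
apply: differentiable_continuous; apply/derivable1_diffP; apply: derivable_powR.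
by rewrite in_itv/= f0.
Qed.

(** The differentiability of the power settles points where f is nonzero; at a zero,
    [|f y| < e^(1/b)] gives the bound e. *)
Lemma norm_powR_continuous (f : R -> R) b : 0 < b -> continuous f ->
  continuous (fun x => `|f x| `^ b).
Proof.
move=> b0 cf x.
have cn : `|f y| @[y --> x] --> `|f x| by apply: cvg_norm; exact: cf.
have [fx0|fx0] := eqVneq (f x) 0; last first.
  apply: (@continuous_comp _ _ _ (fun y => `|f y|) (fun y => y `^ b)); first exact: cn.
  apply: differentiable_continuous; apply/derivable1_diffP; apply: derivable_powR.
  by rewrite in_itv/= normr_gt0 fx0.
rewrite /continuous_at fx0 normr0 powR0 ?gt_eqF//; apply/cvgr0Pnorm_lt => e e0.
have := cn; rewrite fx0 normr0 => /cvgr0Pnorm_lt/(_ (e `^ b^-1)).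
rewrite powR_gt0// => /(_ isT); apply: filterS => y; rewrite normr_id => ye.
rewrite ger0_norm ?powR_ge0//.
have -> : e = (e `^ b^-1) `^ b by rewrite -powRrM mulVf ?gt_eqF// powRr1// ltW.
by apply: gt0_ltr_powR => //; rewrite nnegrE ?powR_ge0.
Qed.

(* Change of variables x = phi y. *)
Lemma finslerE r phi h : 0 < r -> Diff phi -> (forall x, derivable h x 1) ->
  continuous h^`() ->
  finsler r phi h =
  ((\int[mu]_x (`|derive1 phi x `^ (r^-1 - 1) * derive1 h x| `^ r)%:E) `^ r^-1)%E.
Proof.
move=> r0 Dphi dh ch; rewrite /finsler; congr (_ `^ _)%E.
have rn0 : r != 0 by rewrite gt_eqF.
pose q x := derive1 h x / derive1 phi x.
have cq : continuous q.
  move=> x; apply: cvgM; first exact: ch.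
  by apply: cvgV; [rewrite gt_eqF// Diff_derive1_gt0|exact: Diff_derive1_continuous].
have dE : derive1 (h \o diff_inv phi) = q \o diff_inv phi.
  apply/funext => x; apply: is_derive_derive1.
  have := @is_derive1_comp R h (diff_inv phi) x _ _
    (derivable_is_derive (dh _)) (diff_inv_is_derive x Dphi).
  exact.
rewrite dE.
have ci : continuous (diff_inv phi).
  by apply: derivable_continuous => x; case: (diff_inv_is_derive x Dphi).
have [cN cP] := Diff_cvg Dphi.
have [_ wphi _ _] := Diff_derive1 Dphi; have [lN lP] := Winf_cvg0 wphi.
have l1 (F : set_system R) (FF : Filter F) : derive1 phi x - 1 @[x --> F] --> 0 ->
    derive1 phi x @[x --> F] --> (0 + 1 : R).
  move=> l; rewrite (_ : derive1 phi = (fun x => (derive1 phi x - 1) + 1)).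
    by apply: cvgD => //; exact: cvg_cst.
  by apply/funext => x; rewrite subrK.
rewrite (@increasing_ge0_integration_by_substitutionT R phi
  (fun x => `|(q \o diff_inv phi) x| `^ r)).
(* With p = [phi'], the claim is |h'/p|^r p = |p^(1/r - 1) h'|^r, that is, r (1/r - 1) = 1 - r. *)
- apply: eq_integral => x _; congr EFin; rewrite !fctE /= diff_invK//.
  have p0 := Diff_derive1_gt0 x Dphi.
  rewrite /q !normrM normfV (gtr0_norm p0).
  rewrite (gtr0_norm (powR_gt0 _ p0)) !powRM ?invr_ge0 ?powR_ge0 ?(ltW p0)//.
  rewrite -(powR_inv1 (ltW p0)) -!powRrM -mulrA mulrC; congr (_ * _).
  rewrite -[X in _ * X](powRr1 (ltW p0)) -powRD; last by apply/implyP => _; rewrite (gt_eqF p0).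
  by congr (_ `^ _); rewrite mulrBl mulVf// mul1r mulN1r addrC.
- exact: Diff_increasing.
- exact: Diff_derive1_continuous.
- by apply: cvgP; exact: (l1 _ _ lN).
- by apply: cvgP; exact: (l1 _ _ lP).
- by move=> x; exact: Diff_derivable.
- exact: cN.
- exact: cP.
- apply: norm_powR_continuous => // x.
  by apply: continuous_comp; [exact: ci|exact: cq].
- by move=> x; exact: powR_ge0.
Qed.

End diffeomorphism.

(** * Curves in L^1 and C^0 *)

Section C1_curves.
Context {R : realType}.
Local Notation mu := (@lebesgue_measure R).
Implicit Types (a b s t d e k : R) (G D : R -> R).

(* G is continuously differentiable on [a, b] with derivative D (one-sided at the ends). *)
Definition C1_curve a b G D := forall t, a <= t <= b -> forall e, 0 < e ->
  exists2 d, 0 < d & forall s, a <= s <= b -> `|s - t| < d ->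
    `|G s - G t - (s - t) * D t| <= e * `|s - t| /\ `|D s - D t| <= e.

Lemma C1_curve_continuous a b G D : a < b -> C1_curve a b G D ->
  {within `[a, b], continuous G} /\ {within `[a, b], continuous D}.
Proof.
move=> ab GD; split; apply/subspace_continuousP => t /=; rewrite in_itv/= => tab;
  apply/cvgrPdist_le => e e0.
- have [d d0 Hd] := GD t tab 1 ltr01.
  have K0 : 0 < 1 + `|D t| by rewrite ltr_wpDr.
  have de : 0 < Num.min d (e / (1 + `|D t|)) by rewrite lt_min d0 divr_gt0.
  rewrite near_withinE; exists (Num.min d (e / (1 + `|D t|))) => //= s std.
  have {std} : `|s - t| < Num.min d (e / (1 + `|D t|)) by move: std; rewrite /= distrC.
  rewrite lt_min => /andP[sd se] /[!in_itv]/= sab.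
  have [h _] := Hd s sab sd; rewrite distrC.
  have -> : G s - G t = (G s - G t - (s - t) * D t) + (s - t) * D t by rewrite subrK.
  rewrite (le_trans (ler_normD _ _))// normrM (le_trans (lerD h (lexx _)))//.
  rewrite [X in _ + X]mulrC -mulrDl mulrC -ler_pdivlMr//; exact: ltW.
- have [d d0 Hd] := GD t tab e e0.
  rewrite near_withinE; exists d => //= s std /[!in_itv]/= sab.
  have sd : `|s - t| < d by move: std; rewrite /= distrC.
  by rewrite distrC; have [] := Hd s sab sd.
Qed.

Lemma C1_curve_is_derive a b G D t : C1_curve a b G D -> a < t < b ->
  is_derive t (1 : R) G (D t).
Proof.
move=> GD tab; have tab' : a <= t <= b by lra.
suff cv : h^-1 *: (G (h *: (1 : R) + t) - G t) @[h --> 0^'] --> D t.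
  by apply: DeriveDef; [apply/cvg_ex; exists (D t)|exact/cvg_lim].
apply/cvgrPdist_le => e e0; have [d d0 Hd] := GD t tab' e e0.
pose d' := Num.min d (Num.min (t - a) (b - t)).
have d'0 : 0 < d' by rewrite !lt_min d0 !subr_gt0.
exists d' => //= h hd h0; have {hd} : `|h| < d' by move: hd; rewrite /= sub0r normrN.
rewrite /d' !lt_min => /and3P[hd ha hb].
have hE : h *: (1 : R) + t - t = h by rewrite addrK /GRing.scale/= mulr1.
have [|| + _] := Hd (h *: (1 : R) + t).
- move: ha hb; rewrite !ltr_norml /GRing.scale/= mulr1; lra.
- by rewrite hE.
rewrite hE => H1; rewrite -(ler_pM2r (_ : 0 < `|h|)) ?normr_gt0//.
apply: le_trans H1; rewrite -normrM distrC mulrBl /GRing.scale/=.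
by rewrite mulrAC mulVf// mul1r [D t * h]mulrC.
Qed.

Lemma C1_curve_sub a b G D a' b' : C1_curve a b G D -> a <= a' -> b' <= b ->
  C1_curve a' b' G D.
Proof.
move=> GD aa bb t tab e e0; have [|d d0 Hd] := GD t _ e e0; first by lra.
by exists d => // s sab; apply: Hd; lra.
Qed.

Lemma C1_curve_MVT a b G D : a <= b -> C1_curve a b G D ->
  exists2 c, a <= c <= b & G b - G a = D c * (b - a).
Proof.
rewrite le_eqVlt => /predU1P[->|ab] GD.
  by exists b; rewrite ?lexx// !subrr mulr0.
have [||c] := @MVT R G D a b ab.
- by move=> x /[!in_itv]/= xab; exact: C1_curve_is_derive GD xab.
- exact: (C1_curve_continuous ab GD).1.
by rewrite in_itv/= => cab ->; exists c => //; lra.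
Qed.

Lemma C1_curve_FTC a b G D : a < b -> C1_curve a b G D ->
  \int[mu]_(t in `[a, b]) D t = G b - G a.
Proof.
move=> ab GD; have [cG cD] := C1_curve_continuous ab GD.
have LR : derivable_oo_LRcontinuous G a b.
  have [_ ca cb] := (continuous_within_itvP G ab).1 cG; split => // x.
  by rewrite in_itv/= => xab; case: (C1_curve_is_derive GD xab).
have G' : {in `]a, b[%R, G^`() =1 D}.
  move=> x xab; have {}xab : a < x < b by move: xab; rewrite in_itv.
  apply: is_derive_derive1.
  exact: C1_curve_is_derive GD xab.
by rewrite /Rintegral (continuous_FTC2 ab cD LR G').
Qed.

Lemma C1_curve_le a b G D k : a <= b -> C1_curve a b G D ->
  (forall t, a <= t <= b -> D t <= k) -> G b - G a <= k * (b - a).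
Proof.
move=> ab GD Dk; have [c cab ->] := C1_curve_MVT ab GD.
by rewrite ler_wpM2r ?subr_ge0// Dk.
Qed.

(** The bound on D over [a, s] and over [s, b] encloses G s between equal values, so G is affine
    with slope k. *)
Lemma C1_curve_eq a b G D k : a < b -> C1_curve a b G D ->
  (forall t, a <= t <= b -> D t <= k) -> k * (b - a) <= G b - G a ->
  forall t, a < t < b -> D t = k.
Proof.
move=> ab GD Dk kG t tab.
have GE s : a <= s <= b -> G s = k * (s - a) + G a.
  move=> /andP[as_ sb]; apply/eqP; rewrite eq_le; apply/andP; split.
    rewrite -lerBlDr; apply: C1_curve_le as_ (C1_curve_sub GD (lexx _) sb) _ => u u_.
    by apply: Dk; lra.
  have : G b - G s <= k * (b - s).
    apply: C1_curve_le sb (C1_curve_sub GD as_ (lexx _)) _ => u u_.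
    by apply: Dk; lra.
  by move: kG; lra.
have dG := C1_curve_is_derive GD tab.
have dk : is_derive t (1 : R) G k.
  have := is_deriveD (is_deriveZ k (is_deriveB (is_derive_id t (1 : R))
    (is_derive_cst a t (1 : R)))) (is_derive_cst (G a) t (1 : R)).
  rewrite subr0 addr0 /GRing.scale/= mulr1; apply: near_eq_is_derive.
  near=> s; rewrite !fctE/= [RHS]GE//.
  by apply/andP; split; apply: ltW; near: s; [apply: lt_nbhsr|apply: lt_nbhsl]; case/andP: tab.
by rewrite -(is_derive_derive1 dG) (is_derive_derive1 dk).
Unshelve. all: by end_near. Qed.

Lemma C1_curve_affine a b G D k : C1_curve a b G D ->
  (forall t, a < t < b -> D t = k) -> forall t, a <= t <= b -> G t - G a = k * (t - a).
Proof.
move=> GD Dk t /andP[]; rewrite le_eqVlt => /predU1P[<- _|at_ tb].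
  by rewrite !subrr mulr0.
have GDt := C1_curve_sub GD (lexx _) tb.
have [||c] := @MVT R G D a t at_.
- by move=> x /[!in_itv]/= xab; exact: C1_curve_is_derive GDt xab.
- exact: (C1_curve_continuous at_ GDt).1.
by rewrite in_itv/= => cab ->; rewrite Dk//; lra.
Qed.

End C1_curves.

Section bounded_curves.
Context {R : realType}.
Local Notation mu := (@lebesgue_measure R).
Local Notation L1 u := (mu.-integrable setT (EFin \o u)).
Implicit Types (a b c s t d e k M L : R) (u v w : R -> R) (Y V : R -> R -> R).

(* The norm of u in the intersection of L^1 and C^0 is at most e. *)
Definition small u e :=
  [/\ continuous u, L1 u, forall x, `|u x| <= e & \int[mu]_x `|u x| <= e].

Lemma small_ge0 u e : small u e -> 0 <= e.
Proof. by case=> _ _ _; apply: le_trans; exact: Rintegral_ge0. Qed.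

Lemma small_le u e e' : small u e -> e <= e' -> small u e'.
Proof.
by case=> cu u1 ue ie ee; split => // [x|]; [exact: le_trans (ue x) ee|exact: le_trans ie ee].
Qed.

(** Both norms respect pointwise domination, which reduces later estimates to pointwise ones. *)
Lemma small_combination u v w e1 e2 k1 k2 : small u e1 -> small v e2 ->
  0 <= k1 -> 0 <= k2 -> continuous w ->
  (forall x, `|w x| <= k1 * `|u x| + k2 * `|v x|) -> small w (k1 * e1 + k2 * e2).
Proof.
move=> [cu u1 ue ie] [cv v1 ve iv] k10 k20 cw wuv.
have i1 : L1 (fun x => k1 * `|u x|) by exact/L1Zl/L1_norm.
have i2 : L1 (fun x => k2 * `|v x|) by exact/L1Zl/L1_norm.
have iw : L1 w.
  by apply: (L1_le (continuous_measurable_fun cw) wuv); exact: L1D.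
split => // [x|]; first by rewrite (le_trans (wuv x))// lerD// ler_wpM2l.
apply: (@le_trans _ _ (\int[mu]_x (k1 * `|u x| + k2 * `|v x|))).
  by apply: le_Rintegral => //; [exact: L1_norm|exact: L1D].
by rewrite RintegralD// !RintegralZl ?lerD ?ler_wpM2l//; exact: L1_norm.
Qed.

(** The L^1 norm of [u'] bounds the values of u, so the W^{1,1} norm controls both norms in
    [small]. *)
Lemma Winf_small u e : Winf u -> (sobolev1_norm 1 u <= e%:E)%E -> small u e.
Proof.
move=> wu; rewrite sobolev1_normS sobolev1_norm0.
have wu' := Winf_derive1 wu.
rewrite (L1_EFin (L1_norm (Winf_L1 wu))) (L1_EFin (L1_norm (Winf_L1 wu'))) -EFinD lee_fin => ue.
have i0 : 0 <= \int[mu]_x `|u x| by exact: Rintegral_ge0.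
have i1 : 0 <= \int[mu]_x `|derive1 u x| by exact: Rintegral_ge0.
split; [exact: Winf_continuous|exact: Winf_L1| |by apply: le_trans ue; rewrite lerDl].
by move=> x; apply: (le_trans (Winf_le x wu)); apply: le_trans ue; rewrite lerDr.
Qed.

Lemma Winf_small_ex u : Winf u -> exists2 e, 0 <= e & small u e.
Proof.
move=> wu; exists (\int[mu]_x `|u x| + \int[mu]_x `|derive1 u x|).
  by rewrite addr_ge0//; exact: Rintegral_ge0.
have wu' := Winf_derive1 wu.
apply: Winf_small => //; rewrite sobolev1_normS sobolev1_norm0.
by rewrite (L1_EFin (L1_norm (Winf_L1 wu))) (L1_EFin (L1_norm (Winf_L1 wu'))).
Qed.

(* Continuously differentiable curves in the intersection of L^1 and C^0, up to a
   translation. *)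
Definition L1C0_curve a b Y V := forall t, a <= t <= b -> forall e, 0 < e ->
  exists2 d, 0 < d & forall s, a <= s <= b -> `|s - t| < d ->
    small (fun x => Y s x - Y t x - (s - t) * V t x) (e * `|s - t|) /\
    small (fun x => V s x - V t x) e.

Lemma L1C0_curve_eval a b Y V x : L1C0_curve a b Y V ->
  C1_curve a b (fun t => Y t x) (fun t => V t x).
Proof.
move=> YV t tab e e0; have [d d0 Hd] := YV t tab e e0; exists d => // s sab sd.
by have [[_ _ h1 _] [_ _ h2 _]] := Hd s sab sd.
Qed.

Lemma Rintegral_mul_le u v e M : small u e -> measurable_fun setT v ->
  (forall x, `|v x| <= M) -> 0 <= M -> `|\int[mu]_x (u x * v x)| <= M * e.
Proof.
move=> [cu u1 ue ie] mv vM M0.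
have iuv := L1_bounded_mul mv vM u1.
apply: (le_trans (le_normr_Rintegral _ iuv)) => //.
apply: (@le_trans _ _ (\int[mu]_x (M * `|u x|))).
  apply: le_Rintegral => //; [exact: L1_norm|exact/L1Zl/L1_norm|].
  by move=> x _; rewrite normrM mulrC ler_wpM2r.
by rewrite RintegralZl ?ler_wpM2l//; exact: L1_norm.
Qed.

(** Pairing with a bounded v is continuous for the L^1 norm. Increments from [Y a] are paired
    because [Y t], close to a nonzero constant at infinity in the application, is not integrable. *)
Lemma L1C0_curve_pairing a b Y V v M : L1C0_curve a b Y V ->
  measurable_fun setT v -> (forall x, `|v x| <= M) ->
  (forall t, a <= t <= b -> L1 (fun x => Y t x - Y a x)) ->
  (forall t, a <= t <= b -> L1 (V t)) ->
  C1_curve a b (fun t => \int[mu]_x ((Y t x - Y a x) * v x))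
               (fun t => \int[mu]_x (V t x * v x)).
Proof.
move=> YV mv vM iY iV t tab e e0.
have M0 : 0 <= M by exact: le_trans (normr_ge0 _) (vM 0).
have M1 : 0 < M + 1 by rewrite ltr_wpDl.
(* M may be 0, hence the division by M + 1. *)
have [|d d0 Hd] := YV t tab (e / (M + 1)); first by rewrite divr_gt0.
exists d => // s sab sd; have [sm1 sm2] := Hd s sab sd.
have iv u : L1 u -> L1 (fun x => u x * v x) by exact: L1_bounded_mul.
have Me k : 0 <= k -> M * (e / (M + 1) * k) <= e * k.
  move=> k0; rewrite mulrA ler_wpM2r// mulrA ler_pdivrMr// mulrC ler_wpM2l ?lerDl//.
  exact: ltW.
split.
- have -> : \int[mu]_x ((Y s x - Y a x) * v x) - \int[mu]_x ((Y t x - Y a x) * v x) -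
      (s - t) * \int[mu]_x (V t x * v x) =
      \int[mu]_x ((Y s x - Y t x - (s - t) * V t x) * v x).
    have i1 := iv _ (iY s sab); have i2 := iv _ (iY t tab); have i3 := iv _ (iV t tab).
    rewrite -RintegralZl// -RintegralB// -RintegralB//; last 2 first.
      exact: L1B.
      exact: L1Zl.
    by apply: eq_Rintegral => x _; ring.
  by apply: (le_trans (Rintegral_mul_le sm1 mv vM M0)); exact: Me.
- have -> : \int[mu]_x (V s x * v x) - \int[mu]_x (V t x * v x) =
      \int[mu]_x ((V s x - V t x) * v x).
    have i1 := iv _ (iV s sab); have i2 := iv _ (iV t tab).
    by rewrite -RintegralB//; apply: eq_Rintegral => x _; rewrite mulrBl.
  apply: (le_trans (Rintegral_mul_le sm2 mv vM M0)).
  by have := Me 1 ler01; rewrite !mulr1.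
Qed.

Lemma powR_lipschitz c M b : 0 < c -> exists2 L, 0 <= L &
  forall x y, c <= x <= M -> c <= y <= M -> `|y `^ b - x `^ b| <= L * `|y - x|.
Proof.
move=> c0; exists (`|b| * (c `^ (b - 1) + M `^ (b - 1))).
  by rewrite mulr_ge0// addr_ge0// powR_ge0.
move=> x y xcM ycM; apply: (@MVT_le _ (fun z => z `^ b) (fun z => b * z `^ (b - 1)) c M) => //.
  by move=> z /andP[cz _]; apply: is_derive1_powR; exact: lt_le_trans cz.
move=> z /andP[cz zM]; rewrite normrM ler_wpM2l// ger0_norm ?powR_ge0//.
exact: powR_le_itv.
Qed.

Lemma powR_taylor c M b : 0 < c -> exists2 L, 0 <= L &
  forall x y, c <= x <= M -> c <= y <= M ->
    `|y `^ b - x `^ b - (y - x) * (b * x `^ (b - 1))| <= L * `|y - x| * `|y - x|.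
Proof.
move=> c0; have [L L0 HL] := powR_lipschitz M (b - 1) c0.
exists (`|b| * L); first by rewrite mulr_ge0.
move=> x y xcM ycM.
apply: (@taylor_le _ (fun z => z `^ b) (fun z => b * z `^ (b - 1)) c M) => //.
- by rewrite mulr_ge0.
- by move=> z /andP[cz _]; apply: is_derive1_powR; exact: lt_le_trans cz.
- by move=> z zcM; rewrite -mulrBr normrM -mulrA ler_wpM2l// HL.
Qed.

End bounded_curves.

(** * Root curves of paths of diffeomorphisms *)

Section path_curves.
Context {R : realType}.
Implicit Types (a b c s t d e k M L A r : R) (u v w : R -> R) (Y V q : R -> R -> R).

(** The chain rule for y -> r y^(1/r). Near time t the values of Y stay in a compact interval of
    positive numbers, where this map has a quadratic Taylor remainder; the square of an increment is
    small in L^1 because one factor is small uniformly and the other in L^1. *)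
Lemma L1C0_curve_powR a b r Y V : 0 < r -> L1C0_curve a b Y V ->
  (forall t, a <= t <= b -> continuous (Y t)) ->
  (forall t, a <= t <= b -> exists c M, 0 < c /\ forall x, c <= Y t x <= M) ->
  (forall t, a <= t <= b -> exists2 A, 0 <= A & small (V t) A) ->
  L1C0_curve a b (fun t x => r * Y t x `^ r^-1) (fun t x => Y t x `^ (r^-1 - 1) * V t x).
Proof.
move=> r0 YV cY YcM VA t tab e e0.
have Y0 s x : a <= s <= b -> 0 < Y s x.
  by move=> /YcM[c [M [c0 /(_ x)/andP[cY_ _]]]]; exact: lt_le_trans cY_.
have [c [M [c0 YtcM]]] := YcM t tab; have [A A0 sA] := VA t tab.
have c20 : 0 < c / 2 by rewrite divr_gt0.
pose b' := r^-1 - 1.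
(* [c/2, M + 1] leaves room around the range of [Y t] for the values of [Y s] with s near t. *)
have [K K0 HK] := powR_taylor (M + 1) r^-1 c20.
have [L L0 HL] := powR_lipschitz (M + 1) b' c20.
pose B := (c / 2) `^ b' + (M + 1) `^ b'.
have B0 : 0 <= B by rewrite addr_ge0// powR_ge0.
have A1 : 0 < A + 1 by rewrite ltr_wpDl.
(* With D = |s - t|, the first estimate has coefficient Q1 on the remainder of Y and Q2 D^2 on
   [V t]; the second has B on [V s - V t] and Q3 D on [V t]. As A bounds [V t], Q below dominates
   both totals, and its summand 1 makes it positive. *)
pose Q1 := r * K * (A + 1) + B; pose Q2 := r * K * (A + 1); pose Q3 := L * (A + 1).
have Q20 : 0 <= Q2 by rewrite !mulr_ge0// ltW.
have Q10 : 0 <= Q1 by rewrite addr_ge0.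
have Q30 : 0 <= Q3 by rewrite !mulr_ge0// ltW.
pose Q := Q1 + Q2 * A + Q3 * A + 1.
have Q2A : 0 <= Q2 * A by rewrite mulr_ge0.
have Q3A : 0 <= Q3 * A by rewrite mulr_ge0.
have Q0 : 0 < Q by rewrite /Q; lra.
pose f := e / (2 * Q).
have f0 : 0 < f by rewrite divr_gt0// mulr_gt0.
have Qf : Q * f = e / 2 by rewrite /f; field; rewrite gt_eqF.
pose e1 := Num.min 1 f.
have e10 : 0 < e1 by rewrite lt_min ltr01.
have e11 : e1 <= 1 by rewrite ge_min lexx.
have e1f : e1 <= f by rewrite ge_min lexx orbT.
have [d1 d10 Hd] := YV t tab e1 e10.
(* Keeps (A + 1) |s - t|, a uniform bound of [Y s - Y t], below both 1 and c/2. *)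
pose d2 := Num.min 1 (c / 2) / (A + 1).
have d20 : 0 < d2 by rewrite divr_gt0// lt_min ltr01.
exists (Num.min d1 (Num.min 1 (Num.min f d2))); first by rewrite !lt_min d10 ltr01 f0.
move=> s sab; rewrite !lt_min => /and4P[sd1 sd2 sd3 sd4].
have [sm1 sm2] := Hd s sab sd1.
have [crem _ remx _] := sm1; have [cV _ Vx _] := sA.
pose D := `|s - t|; rewrite -/D in sm1 remx sd1 sd2 sd3 sd4 *.
have D0 : 0 <= D by exact: normr_ge0.
pose rem x := Y s x - Y t x - (s - t) * V t x.
have incr x : `|Y s x - Y t x| <= `|rem x| + D * `|V t x|.
  have -> : Y s x - Y t x = rem x + (s - t) * V t x by rewrite /rem subrK.
  by rewrite (le_trans (ler_normD _ _))// normrM.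
have incr2 x : `|Y s x - Y t x| <= (A + 1) * D.
  apply: (le_trans (incr x)); rewrite mulrDl mul1r addrC lerD//.
    by rewrite mulrC ler_wpM2r.
  by apply: (le_trans (remx x)); rewrite ler_piMl.
have AD : (A + 1) * D <= 1 /\ (A + 1) * D <= c / 2.
  move: sd4; rewrite /d2 ltr_pdivlMr// mulrC lt_min => /andP[h1 h2].
  by split; exact: ltW.
have Yt x : c / 2 <= Y t x <= M + 1.
  have /andP[h1 h2] := YtcM x; apply/andP; split; last by clear -h2; lra.
  by apply: le_trans h1; rewrite ler_pdivrMr// ler_peMr ?ler1n// ltW.
have Ys x : c / 2 <= Y s x <= M + 1.
  have /andP[h1 h2] := YtcM x; have := incr2 x; case: AD => h3 h4.
  by rewrite ler_norml => /andP[h5 h6]; clear -h1 h2 h3 h4 h5 h6; apply/andP; split; lra.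
have YB u x : c / 2 <= u x <= M + 1 -> `|u x `^ b'| <= B.
  by move=> /andP[h1 h2]; rewrite ger0_norm ?powR_ge0//; exact: powR_le_itv.
have cYb s' b'' : a <= s' <= b -> continuous (fun x => Y s' x `^ b'').
  by move=> sab'; apply: powR_continuous; [exact: cY|move=> x; exact: Y0].
split.
- have := @small_combination _ rem (V t) (fun x =>
    r * Y s x `^ r^-1 - r * Y t x `^ r^-1 - (s - t) * (Y t x `^ b' * V t x))
    (e1 * D) A Q1 (Q2 * D * D) sm1 sA Q10.
  move=> h; apply: (small_le (h _ _ _)).
  + by rewrite mulr_ge0// mulr_ge0.
  + move=> x; apply: cvgB; [apply: cvgB|]; apply: cvgM; try exact: cvg_cst.
    * exact: cYb.
    * exact: cYb.
    * by apply: cvgM; [exact: cYb|exact: cV].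
  + move=> x.
    (* The Taylor remainder of the power, plus the remainder of the curve Y multiplied by the
       derivative of the power map. *)
    have -> : r * Y s x `^ r^-1 - r * Y t x `^ r^-1 - (s - t) * (Y t x `^ b' * V t x) =
        r * (Y s x `^ r^-1 - Y t x `^ r^-1 - (Y s x - Y t x) * (r^-1 * Y t x `^ b')) +
        Y t x `^ b' * rem x.
      by rewrite /rem; field; rewrite gt_eqF.
    apply: (le_trans (ler_normD _ _)); rewrite !normrM (gtr0_norm r0).
    have h1 := HK _ _ (Yt x) (Ys x); rewrite -/b' in h1.
    (* One factor is bounded uniformly in x; the other keeps its dependence on x, hence its
       integrability. *)
    have h2 : K * `|Y s x - Y t x| * `|Y s x - Y t x| <=
        K * ((A + 1) * D) * (`|rem x| + D * `|V t x|).
      by rewrite ler_pM ?mulr_ge0// ler_wpM2l.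
    have h3 : `|Y t x `^ b'| * `|rem x| <= B * `|rem x|.
      by rewrite ler_wpM2r//; exact: YB.
    have h4 : r * K * (A + 1) * D * `|rem x| <= r * K * (A + 1) * `|rem x|.
      by rewrite ler_wpM2r// ler_piMr// ltW.
    apply: (le_trans (lerD (ler_wpM2l (ltW r0) (le_trans h1 h2)) h3)).
    by rewrite /Q1 /Q2; clear -h4; lra.
  + have h1 : Q1 * e1 <= Q1 * f by rewrite ler_wpM2l.
    have h2 : Q2 * A * D <= Q2 * A * f by rewrite ler_wpM2l// ltW.
    have h3 : Q1 * f + Q2 * A * f <= e / 2.
      by rewrite -Qf -mulrDl ler_wpM2r ?(ltW f0)// /Q; clear -Q3A; lra.
    have -> : Q1 * (e1 * D) + Q2 * D * D * A = (Q1 * e1 + Q2 * A * D) * D by ring.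
    rewrite ler_wpM2r// (le_trans (lerD h1 h2))// (le_trans h3)//.
    by rewrite ler_pdivrMr// ler_peMr ?ler1n// ltW.
- have := @small_combination _ (fun x => V s x - V t x) (V t) (fun x =>
    Y s x `^ b' * V s x - Y t x `^ b' * V t x) e1 A B (Q3 * D) sm2 sA B0.
  have [A' _ sVs] := VA s sab; have [cVs _ _ _] := sVs.
  move=> h; apply: (small_le (h _ _ _)).
  + by rewrite mulr_ge0.
  + move=> x; apply: cvgB; apply: cvgM; [exact: cYb|exact: cVs|exact: cYb|exact: cV].
  + move=> x.
    have -> : Y s x `^ b' * V s x - Y t x `^ b' * V t x =
      Y s x `^ b' * (V s x - V t x) + (Y s x `^ b' - Y t x `^ b') * V t x by ring.
    apply: (le_trans (ler_normD _ _)); rewrite !normrM lerD// ler_wpM2r//; first exact: YB.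
    apply: (le_trans (HL _ _ (Yt x) (Ys x))).
    by rewrite /Q3 -mulrA ler_wpM2l.
  + have h1 : B * e1 <= B * f by rewrite ler_wpM2l.
    have h2 : Q3 * A * D <= Q3 * A * f by rewrite ler_wpM2l// ltW.
    have h3 : B * f + Q3 * A * f <= e / 2.
      rewrite -Qf -mulrDl ler_wpM2r ?(ltW f0)// /Q /Q1 -/Q2.
      by clear -Q2A Q20; lra.
    rewrite mulrAC (le_trans (lerD h1 h2))// (le_trans h3)//.
    by rewrite ler_pdivrMr// ler_peMr ?ler1n// ltW.
Qed.

Lemma small0 : small (fun=> 0 : R) 0.
Proof.
split.
- by move=> x; exact: cvg_cst.
- exact: integrable0.
- by move=> x; rewrite normr0.
- by under eq_Rintegral do rewrite normr0; rewrite Rintegral_cst// mul0r.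
Qed.

Lemma near0_le (F : set_system R) {FF : Filter F} (f : R -> \bar R) e : 0 < e ->
  f s @[s --> F] --> 0%E -> \forall s \near F, (f s <= e%:E)%E.
Proof.
move=> e0 /fine_cvgP[ff /cvgr0Pnorm_le/(_ _ e0)]; apply: filterS2 ff => s fs fe.
by rewrite -(fineK fs) lee_fin (le_trans (ler_norm _)).
Qed.

(** The seminorm of index 1 is the W^{1,1} norm of the derivative, which is what [Winf_small]
    requires. *)
Lemma path_curve a b q : is_path a b q ->
  L1C0_curve a b (fun t => derive1 (q t)) (fun t => derive1 (velocity a b q t)).
Proof.
move=> pq t tab e e0; have tab' : t \in `[a, b]%R by rewrite in_itv.
have [Dt [dV /sobolev1_infty_Winf WV _] l1 l2] := pq t tab'.
have [d1 /= d10 H1] := near0_le e0 (l1 1%N).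
have [d2 /= d20 H2] := near0_le e0 (l2 1%N).
exists (Num.min d1 d2); first by rewrite lt_min d10.
move=> s sab sd; have /andP[sd1 sd2] : (`|t - s| < d1) && (`|t - s| < d2).
  by rewrite distrC -lt_min.
have sab' : s \in `[a, b]%R by rewrite in_itv.
have [Ds [dVs /sobolev1_infty_Winf WVs _] _ _] := pq s sab'.
have [dqt wqt _ _] := Diff_derive1 Dt; have [dqs wqs _ _] := Diff_derive1 Ds.
split.
  (* The convergence of the difference quotients concerns punctured neighbourhoods, so s = t is
     treated apart. *)
  have [->|st] := eqVneq s t.
    rewrite subrr normr0 mulr0; have := small0; congr (small _ _).
    by apply/funext => x; rewrite mul0r subr0 subrr.
  have := H1 s sd1 st sab'; rewrite /seminorm.
  have -> : (diff_quot q t s \- velocity a b q t)^`() =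
      (fun x => (s - t)^-1 * (derive1 (q s) x - derive1 (q t) x) - derive1 (velocity a b q t) x).
    apply/funext => x; apply: is_derive_derive1.
    exact: is_deriveB (is_deriveZ (s - t)^-1 (is_deriveB (dqs x) (dqt x)))
      (derivable_is_derive (dV x)).
  have WD : Winf (fun x => (s - t)^-1 * (derive1 (q s) x - derive1 (q t) x) -
      derive1 (velocity a b q t) x).
    have := WinfD (WinfZ (s - t)^-1 (WinfD wqs (WinfZ (-1) wqt))) (WinfZ (-1) WV).
    congr Winf; apply/funext => x; rewrite !mulN1r; congr (_ * _ - _); ring.
  move=> /(Winf_small WD) sm.
  have [cD _ _ _] := sm.
  have := @small_combination _ _ _ (fun x => derive1 (q s) x - derive1 (q t) x -
    (s - t) * derive1 (velocity a b q t) x) _ _ `|s - t| 0 sm small0 (normr_ge0 _) (lexx _).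
  have E : `|s - t| * e + 0 * 0 = e * `|s - t| by rewrite mul0r addr0 mulrC.
  rewrite E => h; apply: h.
    move=> x; apply: cvgB; first by apply: cvgB; exact: Diff_derive1_continuous.
    by apply: cvgM; [exact: cvg_cst|exact: Winf_continuous].
  by move=> x; rewrite mul0r addr0 -normrM mulrBr mulrA divff ?subr_eq0// mul1r.
have := H2 s sd2 sab'; rewrite /seminorm.
have -> : (velocity a b q s \- velocity a b q t)^`() =
    (fun x => derive1 (velocity a b q s) x - derive1 (velocity a b q t) x).
  apply/funext => x; apply: is_derive_derive1.
  exact: is_deriveB (derivable_is_derive (dVs x)) (derivable_is_derive (dV x)).
apply: Winf_small; have := WinfD WVs (WinfZ (-1) WV).
by congr Winf; apply/funext => x; rewrite mulN1r.
Qed.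

End path_curves.

(** * Duality in L^r *)

Section tangent_inequality.
Context {R : realType}.
Implicit Types (a b d z k x : R).

Lemma norm_powR_is_derive x r : 0 < x ->
  is_derive x (1 : R) (fun z : R => `|z| `^ r) (r * x `^ (r - 1)).
Proof.
move=> x0; apply: (@near_eq_is_derive R R R (fun z => z `^ r)).
  by near=> z; rewrite ger0_norm//; apply: ltW; near: z; exact: lt_nbhsr.
exact: is_derive1_powR.
Unshelve. all: by end_near. Qed.

(** For x > 0 the function x^r - r b^(r-1) x has derivative r (x^(r-1) - b^(r-1)), so the mean value
    theorem between a and b puts its value at a strictly above that at b. The absolute value in [f]
    makes it continuous on the whole line. *)
Lemma young_lt r a b : 1 < r -> 0 <= a -> 0 <= b -> a != b ->
  r * (a * b `^ (r - 1)) < a `^ r + (r - 1) * b `^ r.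
Proof.
move=> r1 a0 b0 ab; have r0 : 0 < r by exact: lt_trans r1.
have r10 : 0 < r - 1 by rewrite subr_gt0.
pose f x := `|x| `^ r - r * b `^ (r - 1) * x.
have cf : continuous f.
  move=> x; apply: cvgB; first by apply: norm_powR_continuous => // y; exact: cvg_id.
  by apply: cvgM; [exact: cvg_cst|exact: cvg_id].
have df x : 0 < x -> is_derive x (1 : R) f (r * (x `^ (r - 1) - b `^ (r - 1))).
  move=> x0.
  have := is_deriveB (norm_powR_is_derive r x0)
    (is_deriveZ (r * b `^ (r - 1)) (is_derive_id x (1 : R))).
  by apply: eq_is_derive => //; rewrite /GRing.scale/= mulr1 mulrBr.
have fb : f b = (1 - r) * b `^ r.
  by rewrite /f ger0_norm// -(mulr_powRB1 b0 r0); ring.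
suff : f b < f a.
  by rewrite fb /f (ger0_norm a0); clear; lra.
have [ab'|ba|/eqP] := ltgtP a b; last by rewrite (negbTE ab).
- have [||c /[!in_itv]/= /andP[ac cb] E] :=
    @MVT R f (fun x => r * (x `^ (r - 1) - b `^ (r - 1))) a b ab'.
  + by move=> x /[!in_itv]/= /andP[ax _]; apply: df; exact: le_lt_trans ax.
  + exact: continuous_subspaceT.
  have h : c `^ (r - 1) < b `^ (r - 1).
    by apply: gt0_ltr_powR => //; rewrite nnegrE// ltW// (le_lt_trans a0).
  rewrite -subr_lt0 E pmulr_llt0 ?subr_gt0// pmulr_rlt0// subr_lt0//.
- have [||c /[!in_itv]/= /andP[bc ca] E] :=
    @MVT R f (fun x => r * (x `^ (r - 1) - b `^ (r - 1))) b a ba.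
  + by move=> x /[!in_itv]/= /andP[ax _]; apply: df; exact: le_lt_trans ax.
  + exact: continuous_subspaceT.
  have h : b `^ (r - 1) < c `^ (r - 1).
    by apply: gt0_ltr_powR => //; rewrite nnegrE// ltW// (le_lt_trans b0).
  by rewrite -subr_gt0 E pmulr_lgt0 ?subr_gt0// pmulr_rgt0// subr_gt0.
Qed.

(* The duality map sgn(d) |d|^(r-1) of L^r, in a form whose continuity is clear. *)
Definition dual r d := `|Num.max d 0| `^ (r - 1) - `|Num.max (- d) 0| `^ (r - 1).

Lemma dual_ge0E r d : 1 < r -> 0 <= d -> dual r d = d `^ (r - 1).
Proof.
move=> r1 d0; rewrite /dual max_l// max_r ?oppr_le0// normr0 powR0 ?subr0 ?ger0_norm//.
by rewrite gt_eqF// subr_gt0.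
Qed.

Lemma dualN r d : dual r (- d) = - dual r d.
Proof. by rewrite /dual opprK opprB. Qed.

Lemma dualE r d : 1 < r -> dual r d = Num.sg d * `|d| `^ (r - 1).
Proof.
move=> r1; have [d0|d0|->] := ltrgt0P d.
- by rewrite gtr0_sg// mul1r dual_ge0E// ltW.
- by rewrite -[in LHS](opprK d) dualN dual_ge0E ?oppr_ge0 ?(ltW d0)// ltr0_sg// mulN1r.
- by rewrite sgr0 mul0r dual_ge0E// powR0// gt_eqF// subr_gt0.
Qed.

Lemma mul_dual r d : 1 < r -> d * dual r d = `|d| `^ r.
Proof.
move=> r1; rewrite dualE// mulrA [d * _]mulrC -normrEsg mulr_powRB1//.
exact: lt_trans r1.
Qed.

Lemma norm_dual r d : 1 < r -> `|dual r d| = `|d| `^ (r - 1).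
Proof.
move=> r1; rewrite dualE// normrM [X in _ * X]ger0_norm ?powR_ge0//.
have [->|d0] := eqVneq d 0; last by rewrite normr_sg d0 mul1r.
by rewrite sgr0 !normr0 mul0r powR0// gt_eqF// subr_gt0.
Qed.

Lemma dual_scale r k d : 1 < r -> 0 < k -> dual r (k * d) = k `^ (r - 1) * dual r d.
Proof.
move=> r1 k0; rewrite !dualE// sgrM (gtr0_sg k0) mul1r normrM (gtr0_norm k0).
by rewrite powRM ?(ltW k0)// mulrCA.
Qed.

Lemma dual_continuous r (f : R -> R) : 1 < r -> continuous f ->
  continuous (fun x => dual r (f x)).
Proof.
move=> r1 cf x; have r10 : 0 < r - 1 by rewrite subr_gt0.
apply: cvgB.
- apply: (@norm_powR_continuous R (fun x => Num.max (f x) 0) _ r10) => y.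
  by apply: (@continuous_max _ _ f (fun=> 0)); [exact: cf|exact: cvg_cst].
- apply: (@norm_powR_continuous R (fun x => Num.max (- f x) 0) _ r10) => y.
  apply: (@continuous_max _ _ (fun x => - f x) (fun=> 0)); last exact: cvg_cst.
  by apply: cvgN; exact: cf.
Qed.

(** The graph of |z|^r lies above its tangent at d, whose slope is [r * dual r d]; the constant term
    is rewritten by [mul_dual]. Passing to absolute values reduces it to Young's inequality. *)
Lemma tangent_le r z d : 1 < r ->
  r * (z * dual r d) <= `|z| `^ r + (r - 1) * `|d| `^ r.
Proof.
move=> r1; have r0 : 0 < r by exact: lt_trans r1.
apply: (@le_trans _ _ (r * (`|z| * `|d| `^ (r - 1)))).
  by rewrite ler_pM2l// -norm_dual// -normrM ler_norm.
have [->|zd] := eqVneq `|z| `|d|; last by rewrite ltW// young_lt.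
by rewrite mulr_powRB1//; lra.
Qed.

(** The strict Young inequality forces |z| = |d|; if z = -d the two sides have opposite signs, so
    that d = 0. *)
Lemma tangent_eq r z d : 1 < r ->
  r * (z * dual r d) = `|z| `^ r + (r - 1) * `|d| `^ r -> z = d.
Proof.
move=> r1 E; have r0 : 0 < r by exact: lt_trans r1.
have [zd|zd] := eqVneq `|z| `|d|; last first.
  have := young_lt r1 (normr_ge0 z) (normr_ge0 d) zd; rewrite -E.
  by rewrite ltr_pM2l// -norm_dual// -normrM ltNge ler_norm.
move/eqP: (zd); rewrite eqr_norm2 => /orP[/eqP//|/eqP zE].
move: E; rewrite zd zE mulNr mul_dual// => E.
have : r * `|d| `^ r = 0 by lra.
move=> /eqP; rewrite mulf_eq0 (gt_eqF r0)/= => /eqP/powR_eq0_eq0/normr0_eq0 ->.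
by rewrite oppr0.
Qed.

End tangent_inequality.

Section integrals.
Context {R : realType}.
Local Notation mu := (@lebesgue_measure R).
Local Notation L1 u := (mu.-integrable setT (EFin \o u)).
Implicit Types (u f : R -> R).

Lemma continuous_integral_eq0 f : continuous f -> L1 f -> (forall x, 0 <= f x) ->
  \int[mu]_x f x <= 0 -> forall x, f x = 0.
Proof.
move=> cf f1 f0 If x; apply/eqP; rewrite eq_le f0 andbT leNgt; apply/negP => fx.
have [d /= d0 Hd] : \forall y \near x, f x / 2 < f y.
  by apply: (cvgr_gt _ (cf x)); rewrite ltr_pdivrMr// ltr_pMr// ltr1n.
pose e := d / 2; have e0 : 0 < e by rewrite divr_gt0.
have xe : x - e <= x + e by rewrite ler_wpDr ?(ltW e0)// gerBl ltW.
have h1 : \int[mu]_(y in `[x - e, x + e]) (f x / 2) <= \int[mu]_(y in `[x - e, x + e]) f y.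
  apply: le_Rintegral => //.
  - by apply: segment_L1 => z; exact: cvg_cst.
  - exact: segment_L1.
  - move=> y; rewrite /= in_itv/= => /andP[y1 y2]; apply: ltW; apply: Hd => /=.
    by rewrite ltr_norml; move: d0; rewrite /e in y1 y2; clear -y1 y2; lra.
have := le_trans h1 (le_trans (Rintegral_restrict_le (measurable_itv _) f0 f1) If).
have -> : \int[mu]_(y in `[x - e, x + e]) (f x / 2) = f x / 2 * (2 * e).
  rewrite Rintegral_cst//; congr (_ * _); transitivity (fine (mu `[x - e, x + e]%classic)) => //.
  rewrite lebesgue_measure_itv/= lte_fin ltrD2l (_ : - e < e); last by rewrite gtrN.
  by rewrite -EFinB/=; ring.
by rewrite leNgt => /negP; apply; rewrite mulr_gt0 ?divr_gt0// mulr_gt0.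
Qed.

Lemma L1_powR u r (C : R) : 1 < r -> continuous u -> (forall x, `|u x| <= C) -> L1 u ->
  L1 (fun x => `|u x| `^ r).
Proof.
move=> r1 cu uC u1; have r0 : 0 < r by exact: lt_trans r1.
apply: (@L1_le _ _ (fun x => C `^ (r - 1) * `|u x|)).
- by apply: continuous_measurable_fun; exact: norm_powR_continuous.
- move=> x; rewrite ger0_norm ?powR_ge0// -(mulr_powRB1 (normr_ge0 _) r0) mulrC.
  rewrite ler_wpM2r// ge0_ler_powR ?nnegrE ?subr_ge0 ?(ltW r1)//.
  exact: le_trans (uC x).
- exact/L1Zl/L1_norm.
Qed.

(* The integral of a nonnegative function is a lower integral: monotonicity does not
   need the measurability of the larger function. *)
Lemma ge0_le_lower_integral (D : set R) (f g : R -> \bar R) :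
  (forall x, D x -> 0 <= f x)%E -> (forall x, D x -> f x <= g x)%E ->
  (\int[mu]_(x in D) f x <= \int[mu]_(x in D) g x)%E.
Proof.
move=> f0 fg; have g0 x : D x -> (0 <= g x)%E.
  by move=> Dx; exact: le_trans (f0 x Dx) (fg x Dx).
rewrite !ge0_integralE//; apply: ereal_sup_le => _ [h hf <-]; exists h => // x.
apply: (le_trans (hf x)); rewrite !patchE; case: ifPn => // /set_mem; exact: fg.
Qed.

End integrals.

Section duality.
Context {R : realType}.
Local Notation mu := (@lebesgue_measure R).
Local Notation L1 u := (mu.-integrable setT (EFin \o u)).
Variables (r : R) (z d : R -> R) (ez ed : R).
Hypotheses (r1 : 1 < r) (sz : small z ez) (sd : small d ed).

Let r0 : 0 < r. Proof. exact: lt_trans r1. Qed.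

Lemma dual_measurable : measurable_fun setT (fun x => dual r (d x)).
Proof.
by apply: continuous_measurable_fun; apply: dual_continuous => //; case: sd.
Qed.

Lemma dual_bounded x : `|dual r (d x)| <= ed `^ (r - 1).
Proof.
rewrite norm_dual// ge0_ler_powR ?nnegrE ?subr_ge0 ?(ltW r1)//; last by case: sd.
exact: small_ge0 sd.
Qed.

Lemma L1_mul_dual : L1 (fun x => z x * dual r (d x)).
Proof. by apply: (L1_bounded_mul dual_measurable dual_bounded); case: sz. Qed.

Lemma small_L1_powR u e : small u e -> L1 (fun x => `|u x| `^ r).
Proof. by case=> cu u1 ue _; exact: L1_powR r1 cu ue u1. Qed.

(** The defect in the tangent inequality: it is continuous and nonnegative, hence zero everywhere
    once its integral is not positive. *)
Let gap x := `|z x| `^ r + (r - 1) * `|d x| `^ r - r * (z x * dual r (d x)).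

Let gapL1 : L1 gap.
Proof.
apply: L1B; last exact/L1Zl/L1_mul_dual.
by apply: L1D; [exact: small_L1_powR sz|exact/L1Zl/(small_L1_powR sd)].
Qed.

Let gap_ge0 x : 0 <= gap x. Proof. by rewrite subr_ge0 tangent_le. Qed.

Let gapE : \int[mu]_x gap x = \int[mu]_x (`|z x| `^ r) + (r - 1) * \int[mu]_x (`|d x| `^ r) -
  r * \int[mu]_x (z x * dual r (d x)).
Proof.
have i1 := small_L1_powR sz; have i2 := small_L1_powR sd; have i3 := L1_mul_dual.
rewrite RintegralB//; [|by apply: L1D => //; exact: L1Zl|exact: L1Zl].
by rewrite RintegralD// ?RintegralZl//; exact: L1Zl.
Qed.

Lemma tangent_Rintegral_le : r * \int[mu]_x (z x * dual r (d x)) <=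
  \int[mu]_x (`|z x| `^ r) + (r - 1) * \int[mu]_x (`|d x| `^ r).
Proof. by rewrite -subr_ge0 -gapE; exact: Rintegral_ge0. Qed.

Lemma tangent_Rintegral_eq : \int[mu]_x (`|z x| `^ r) + (r - 1) * \int[mu]_x (`|d x| `^ r) <=
  r * \int[mu]_x (z x * dual r (d x)) -> z =1 d.
Proof.
rewrite -subr_le0 -gapE => gap0 x; have [[cz _ _ _] [cd _ _ _]] := (sz, sd).
apply: (tangent_eq r1); apply/esym/eqP; rewrite -subr_eq0; apply/eqP.
apply: (continuous_integral_eq0 _ gapL1 gap_ge0 gap0) => y.
apply: cvgB; [apply: cvgD; [exact: norm_powR_continuous|]|].
  by apply: cvgM; [exact: cvg_cst|exact: norm_powR_continuous].
apply: cvgM; first exact: cvg_cst.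
by apply: cvgM; [exact: cz|exact: dual_continuous].
Qed.

End duality.

(** * Hoelder's inequality from the tangent inequality *)

Section Hoelder.
Context {R : realType}.
Local Notation mu := (@lebesgue_measure R).

Lemma small_scale (d : R -> R) (e k : R) : 0 <= k -> small d e -> small (fun x => k * d x) (k * e).
Proof.
move=> k0 sd; have [cd _ _ _] := sd.
have := @small_combination R d (fun=> 0) (fun x => k * d x) e 0 k 0 sd small0 k0 (lexx _).
rewrite mulr0 addr0; apply.
  by move=> x; apply: cvgM; [exact: cvg_cst|exact: cd].
by move=> x; rewrite normr0 mulr0 addr0 normrM (ger0_norm k0).
Qed.

(** In the application I and N are the integrals of |z|^r and |d|^r, and G is the pairing of z with
    the dual function of d. *)
Lemma optimal_scale (r I N G : R) : 1 < r -> 0 <= I -> 0 < N ->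
  (forall k, 0 < k -> r * (k `^ (r - 1) * G) <= I + (r - 1) * (k `^ r * N)) ->
  G <= I `^ r^-1 * N `^ (1 - r^-1).
Proof.
move=> r1 I0 N0 key; have r0 : 0 < r by exact: lt_trans r1.
have [Ipos|Ile0] := ltP 0 I.
  (* The scale at which k d and z have the same norm: then k^r N = I and the right-hand side is r
     I. *)
  pose k := (I / N) `^ r^-1; pose e := 1 - r^-1.
  have k0 : 0 < k by rewrite powR_gt0// divr_gt0.
  have kr : k `^ r = I / N by rewrite /k -powRrM mulVf ?gt_eqF// powRr1// divr_ge0// ltW.
  have kr1 : k `^ (r - 1) = I `^ e / N `^ e.
    rewrite /k -powRrM (_ : r^-1 * (r - 1) = e); last first.
      by rewrite /e mulrBr mulVf ?gt_eqF// mulr1.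
    rewrite powRM ?invr_ge0 ?(ltW N0)//; congr (_ * _).
    by rewrite -(powR_inv1 (ltW N0)) -powRrM mulN1r powRN.
  have IE : I = I `^ r^-1 * I `^ e.
    rewrite -powRD; last by apply/implyP => _; rewrite gt_eqF.
    by rewrite /e addrC subrK powRr1.
  have := key k k0; rewrite kr divfK ?gt_eqF//.
  rewrite (_ : I + _ = r * I); last by ring.
  rewrite ler_pM2l// => kG; rewrite -(ler_pM2l (powR_gt0 (r - 1) k0)).
  apply: (le_trans kG); rewrite {1}IE kr1 le_eqVlt; apply/orP; left; apply/eqP.
  by field; rewrite gt_eqF// powR_gt0.
have -> : I = 0 by apply/eqP; rewrite eq_le Ile0.
rewrite powR0 ?mul0r; last by rewrite invr_eq0 gt_eqF.
rewrite leNgt; apply/negP => G0.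
(* For I = 0 and G > 0, the scale k = G / N would give r X <= (r - 1) X with X = k^(r-1) G > 0. *)
have GN0 : 0 < G / N by rewrite divr_gt0.
have := key _ GN0; rewrite -(mulr_powRB1 (ltW GN0) r0).
rewrite (_ : G / N * _ * N = (G / N) `^ (r - 1) * G); last by field; rewrite gt_eqF.
have -> : I = 0 by apply/eqP; rewrite eq_le Ile0.
rewrite add0r leNgt => /negP; apply.
by rewrite ltr_pM2r ?mulr_gt0 ?powR_gt0// gtrBl.
Qed.

Lemma powR_le_inv (e x y : R) : 0 < e -> 0 <= x -> 0 <= y -> x `^ e <= y `^ e -> x <= y.
Proof.
move=> e0 x0 y0; rewrite leNgt => /negP h; rewrite leNgt; apply/negP => yx; apply: h.
by apply: gt0_ltr_powR.
Qed.

(* By optimizing [tangent_Rintegral_le] over the multiples of d. *)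
Lemma Hoelder_dual (r : R) (z d : R -> R) (ez ed : R) : 1 < r -> small z ez -> small d ed ->
  0 < \int[mu]_x (`|d x| `^ r) ->
  \int[mu]_x (z x * dual r (d x)) <=
  (\int[mu]_x (`|z x| `^ r)) `^ r^-1 * (\int[mu]_x (`|d x| `^ r)) `^ (1 - r^-1).
Proof.
move=> r1 sz sd N0; apply: (optimal_scale r1 _ N0).
  by apply: Rintegral_ge0 => x _; exact: powR_ge0.
move=> k k0; have := tangent_Rintegral_le r1 sz (small_scale (ltW k0) sd).
under eq_Rintegral do rewrite dual_scale// mulrCA.
under [X in _ <= _ + _ * X -> _]eq_Rintegral do
  rewrite normrM (gtr0_norm k0) (powRM _ (ltW k0))//.
have i1 := L1_mul_dual r1 sz sd; have i2 := small_L1_powR r1 sd.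
by rewrite !RintegralZl.
Qed.

End Hoelder.

(** * Lengths and geodesics *)

Section length.
Context {R : realType}.
Local Notation mu := (@lebesgue_measure R).
Implicit Types (r s t a b x : R) (phi : R -> R) (q : R -> R -> R).

(* phi |-> r phi'^(1/r) is an isometric embedding in an affine space over L^r. *)
Definition root r phi x := r * derive1 phi x `^ r^-1.

(** The time derivative of [root r (q t)], the factor r cancelling the exponent 1/r; by [finslerE]
    its L^r norm is the speed. *)
Definition root_velocity r a b q t x :=
  derive1 (q t) x `^ (r^-1 - 1) * derive1 (velocity a b q t) x.

(** The jet [(1 + t g)^b - 1] at t = 1, with g = [phi' - 1] and b = 1/r. *)
Lemma Diff_root_Winf r phi : Diff phi -> Winf (fun x => derive1 phi x `^ r^-1 - 1).
Proof.
move=> Dphi; have [_ wphi [m [m0 m1 mphi]] _] := Diff_derive1 Dphi.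
have m1' x : m <= 1 + (derive1 phi x - 1) by rewrite addrC subrK.
have := jet_Winf wphi m0 m1 m1' (jet_powR _ r^-1) (_ : 0 <= 1 <= 1).
rewrite ler01 lexx => /(_ isT); congr Winf.
by apply/funext => x; rewrite mul1r [1 + _]addrC subrK.
Qed.

Lemma Diff_bounds phi : Diff phi -> exists c M : R, 0 < c /\ forall x, c <= derive1 phi x <= M.
Proof.
move=> /Diff_derive1[_ wphi [m [m0 _ mphi]] _]; have [C C0 phiC] := Winf_bounded wphi.
exists m, (C + 1); split => // x; rewrite mphi/= -lerBlDr.
by rewrite (le_trans (ler_norm _)).
Qed.

Lemma root_increment_small r phi psi : Diff phi -> Diff psi ->
  exists e, small (fun x => root r phi x - root r psi x) e.
Proof.
move=> Dphi Dpsi; have w1 := Diff_root_Winf r Dphi; have w2 := Diff_root_Winf r Dpsi.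
have [e _ se] := Winf_small_ex (WinfD (WinfZ r w1) (WinfZ (- r) w2)).
exists e; move: se; congr small; apply/funext => x; rewrite /root.
by move: (_ `^ _) (_ `^ _) => A B; ring.
Qed.

Variables (r a b : R) (q : R -> R -> R).
Hypotheses (r1 : 1 < r) (ab : a < b) (pq : is_path a b q).

Let r0 : 0 < r. Proof. exact: lt_trans r1. Qed.

Let inab t : a <= t <= b -> t \in `[a, b]%R. Proof. by rewrite in_itv. Qed.

Lemma root_curve : L1C0_curve a b (fun t => root r (q t)) (root_velocity r a b q).
Proof.
apply: (L1C0_curve_powR r0 (path_curve pq)) => t tab; have [Dt [_ wv _] _ _] := pq (inab tab).
- exact: Diff_derive1_continuous.
- exact: Diff_bounds.
- by apply: Winf_small_ex; exact/sobolev1_infty_Winf.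
Qed.

Lemma root_velocity_small t : a <= t <= b -> exists e, small (root_velocity r a b q t) e.
Proof.
move=> tab; have [Dt [_ /sobolev1_infty_Winf wv _] _ _] := pq (inab tab).
have [e _ se] := Winf_small_ex wv; have [c [M [c0 cM]]] := Diff_bounds Dt.
pose K := c `^ (r^-1 - 1) + M `^ (r^-1 - 1).
have K0 : 0 <= K by rewrite addr_ge0 ?powR_ge0.
have := @small_combination _ _ (fun=> 0) (root_velocity r a b q t) e 0 K 0 se small0 K0 (lexx _).
move=> h; eexists; apply: h => [x|x].
  apply: cvgM; last exact: Winf_continuous.
  apply: powR_continuous; first exact: Diff_derive1_continuous.
  by move=> y; exact: Diff_derive1_gt0.
rewrite mul0r addr0 normrM ler_wpM2r// ger0_norm ?powR_ge0//.
by case/andP: (cM x) => cx xM; exact: powR_le_itv.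
Qed.

Lemma speedE t : a <= t <= b ->
  speed r a b q t = ((\int[mu]_x (`|root_velocity r a b q t x| `^ r)) `^ r^-1)%:E.
Proof.
move=> tab; have [Dt [dv /sobolev1_infty_Winf wv _] _ _] := pq (inab tab).
have [e se] := root_velocity_small tab.
rewrite /speed (finslerE r0 Dt dv (Winf_continuous wv)) -poweR_EFin.
by rewrite -(L1_EFin (small_L1_powR r1 se)).
Qed.

Lemma root_pairing (d : R -> R) ed : small d ed ->
  C1_curve a b (fun t => \int[mu]_x ((root r (q t) x - root r (q a) x) * dual r (d x)))
               (fun t => \int[mu]_x (root_velocity r a b q t x * dual r (d x))).
Proof.
move=> sd; have aab : a <= a <= b by rewrite lexx ltW.
apply: (L1C0_curve_pairing root_curve (dual_measurable r1 sd) (dual_bounded r1 sd)) => t tab.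
  have [Dt _ _ _] := pq (inab tab); have [Da _ _ _] := pq (inab aab).
  by have [e []] := root_increment_small r Dt Da.
by have [e []] := root_velocity_small tab.
Qed.

Lemma path_length_ge :
  (((\int[mu]_x (`|root r (q b) x - root r (q a) x| `^ r)) `^ r^-1)%:E <= path_length r a b q)%E.
Proof.
have aab : a <= a <= b by rewrite lexx ltW.
have bab : a <= b <= b by rewrite lexx ltW.
have [Da _ _ _] := pq (inab aab); have [Db _ _ _] := pq (inab bab).
have [ed sd] := root_increment_small r Db Da.
set d := fun x => _ in sd.
set N := \int[mu]_x _.
have N0 : 0 <= N by apply: Rintegral_ge0 => x _; exact: powR_ge0.
have [Nle0|Npos] := leP N 0.
  have -> : N = 0 by apply/eqP; rewrite eq_le Nle0.
  rewrite powR0; last by rewrite invr_eq0 gt_eqF.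
  by apply: integral_ge0 => t _; exact: poweR_ge0.
pose D t := \int[mu]_x (root_velocity r a b q t x * dual r (d x)).
have C1 := root_pairing sd.
have E := C1_curve_FTC ab C1.
(* k is the norm of the dual function for the conjugate exponent r / (r - 1), so Hoelder's
   inequality bounds D t / k by the speed. *)
pose k := N `^ (1 - r^-1); have k0 : 0 < k by rewrite powR_gt0.
have kN : N / k = N `^ r^-1.
  by rewrite -{1}(powRr1 N0) /k -powRB ?subKr//; apply/implyP => _; rewrite gt_eqF.
have cD : {within `[a, b], continuous D} by exact: (C1_curve_continuous ab C1).2.
have iD : mu.-integrable `[a, b]%classic (EFin \o (fun t => D t / k)).
  apply: continuous_compact_integrable; first exact: segment_compact.
  by move=> t; apply: cvgM; [exact: cD|exact: cvg_cst].
have EN : \int[mu]_(t in `[a, b]) (D t / k) = N `^ r^-1.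
  rewrite RintegralZr//; last first.
    by apply: continuous_compact_integrable => //; exact: segment_compact.
  rewrite E -kN; congr (_ / _).
  rewrite [X in _ - X](_ : _ = 0) ?subr0; last first.
    rewrite (_ : (fun x => _) = (fun=> 0)) ?Rintegral_cst ?mul0r//.
    by apply/funext => x; rewrite subrr mul0r.
  by apply: eq_Rintegral => x _; rewrite mul_dual.
rewrite -EN /Rintegral fineK; last exact: integrable_fin_num.
(* The positive part is nonnegative and still below the speed, as the comparison of lower integrals
   requires. *)
apply: (@le_trans _ _ (\int[mu]_(t in `[a, b]) (Num.max (D t / k) 0)%:E)%E).
  have iM : mu.-integrable `[a, b]%classic (fun t => (Num.max (D t / k) 0)%:E).
    exact: integrable_funrpos.
  apply: le_integral => // t _; by rewrite lee_fin le_max lexx.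
apply: ge0_le_lower_integral => t /=; rewrite in_itv/= => tab.
  by rewrite lee_fin le_max lexx orbT.
have [ez sz] := root_velocity_small tab.
rewrite (speedE tab) lee_fin ge_max; apply/andP; split; last exact: powR_ge0.
rewrite (ler_pdivrMr _ _ k0); exact: (Hoelder_dual r1 sz sd Npos).
Qed.

End length.

(** * Minimality of the linear path and uniqueness *)

Section geodesics.
Context {R : realType}.
Local Notation mu := (@lebesgue_measure R).
Implicit Types (s t a b x : R) (phi : R -> R) (q : R -> R -> R).

Variables (g : R -> R) (m r : R).
Hypotheses (r1 : 1 < r) (wg : Winf g) (m0 : 0 < m) (m1 : m <= 1).
Hypothesis mg : forall x, m <= 1 + g x.

Let r0 : 0 < r. Proof. exact: lt_trans r1. Qed.

Lemma root_linear_path t x : 0 <= t <= 1 ->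
  root r (linear_path g r t) x = r * (1 + t * g x).
Proof.
move=> t01; rewrite /root (is_derive_derive1 (linear_path_is_derive r wg m0 m1 mg x t01)).
by rewrite -powRrM mulfV ?gt_eqF// powRr1// ltW// (affine_gt0 m0 m1 mg).
Qed.

Lemma root_velocity_linear_path a b t x : 0 <= a -> a < b -> b <= 1 -> a <= t <= b ->
  root_velocity r a b (linear_path g r) t x = r * g x.
Proof.
move=> a0 ab b1 tab; have t01 : 0 <= t <= 1 by lra.
have tab' : t \in `[a, b]%R by rewrite in_itv.
rewrite /root_velocity (linear_path_velocity r wg m0 m1 mg a0 ab b1 tab').
rewrite (is_derive_derive1 (linear_path_is_derive r wg m0 m1 mg x t01)).
have [L JK] := jet_dt wg (jet_powR g r); have WK := jet_Winf wg m0 m1 mg JK t01.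
rewrite (is_derive_derive1 (primitive_is_derive x (Winf_continuous WK) (Winf_L1 WK))).
have w0 := affine_gt0 m0 m1 mg x t01.
(* The exponents r (1/r - 1) and r - 1 of [1 + t g] cancel: the image of the path has constant
   velocity. *)
rewrite /power_term expr0 mul1r -powRrM mulrA -powRD; last by apply/implyP => _; rewrite gt_eqF.
rewrite (_ : r * (r^-1 - 1) + (r - 1) = 0) ?powRr0 ?mul1r//.
by rewrite mulrBr mulfV ?gt_eqF// mulr1; ring.
Qed.

Lemma linear_path_speed a b t : 0 <= a -> a < b -> b <= 1 -> a <= t <= b ->
  speed r a b (linear_path g r) t = ((\int[mu]_x (`|r * g x| `^ r)) `^ r^-1)%:E.
Proof.
move=> a0 ab b1 tab.
rewrite (speedE r1 (linear_path_is_path r wg m0 m1 mg a0 ab b1) tab).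
by under eq_Rintegral do rewrite root_velocity_linear_path//.
Qed.

Lemma linear_path_length a b : 0 <= a -> a < b -> b <= 1 ->
  path_length r a b (linear_path g r) =
  ((\int[mu]_x (`|r * g x| `^ r)) `^ r^-1 * (b - a))%:E.
Proof.
move=> a0 ab b1; rewrite /path_length.
rewrite (eq_integral (fun=> ((\int[mu]_x (`|r * g x| `^ r)) `^ r^-1)%:E)); last first.
  by move=> t /set_mem /=; rewrite in_itv/= => tab; exact: linear_path_speed.
by rewrite integral_cst//= lebesgue_measure_itv/= lte_fin ab -EFinD EFinM.
Qed.

(** The image is a segment, so its increment over [a, b] is (b - a) r g, whose norm is the length.
    Holding on every subinterval, this gives local minimality as well. *)
Lemma linear_path_minimizing a b : 0 <= a -> a < b -> b <= 1 ->
  minimizing r a b (linear_path g r).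
Proof.
move=> a0 ab b1 q pq qa qb; apply: le_trans (path_length_ge r1 ab pq).
rewrite linear_path_length// lee_fin qa qb.
have ba0 : 0 < b - a by rewrite subr_gt0.
have a01 : 0 <= a <= 1 by lra.
have b01 : 0 <= b <= 1 by lra.
have wrg := WinfZ r wg; have [e _ se] := Winf_small_ex wrg.
have I0 : 0 <= \int[mu]_x (`|r * g x| `^ r) by apply: Rintegral_ge0 => x _; exact: powR_ge0.
have -> : \int[mu]_x (`|root r (linear_path g r b) x - root r (linear_path g r a) x| `^ r) =
    (b - a) `^ r * \int[mu]_x (`|r * g x| `^ r).
  rewrite -(RintegralZl _ measurableT (small_L1_powR r1 se)); apply: eq_Rintegral => x _.
  rewrite (root_linear_path _ a01) (root_linear_path _ b01) -(powRM _ (ltW ba0) (normr_ge0 _)).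
  rewrite -[in X in _ = X `^ _](gtr0_norm ba0) -normrM; congr (`|_| `^ _).
  by move: (g x) => y; ring.
rewrite powRM ?powR_ge0// -powRrM mulfV ?gt_eqF// powRr1 ?(ltW ba0)//.
by rewrite mulrC.
Qed.

Lemma linear_path_minimizing_geodesic : minimizing_geodesic r (linear_path g r).
Proof.
have z01 : (0 : R) < 1 by exact: ltr01.
split; last exact: linear_path_minimizing.
split; first exact: (linear_path_is_path r wg m0 m1 mg (lexx 0) z01 (lexx 1)).
- exists ((\int[mu]_x (`|r * g x| `^ r)) `^ r^-1) => t; rewrite in_itv/= => t01.
  exact: linear_path_speed.
- by move=> t _; exists 1 => // a b a0 ab b1 _ _; exact: linear_path_minimizing.
Qed.

Lemma linear_path0 : linear_path g r 0 = id.
Proof.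
apply/funext => x; rewrite /linear_path /primitive.
under eq_Rintegral do rewrite mul0r addr0 powR1 subrr.
by rewrite Rintegral_cst// mul0r addr0.
Qed.

Lemma Diff_unique phi psi : Diff phi -> Diff psi -> derive1 phi =1 derive1 psi -> phi = psi.
Proof.
move=> Dphi Dpsi E; apply: derive1_cvgNy_unique E _.
- by move=> x; exact: Diff_derivable.
- by move=> x; exact: Diff_derivable.
have [_ _ _ l1] := Diff_derive1 Dphi; have [_ _ _ l2] := Diff_derive1 Dpsi.
have -> : (fun x => phi x - psi x) = (fun x => (phi x - x) - (psi x - x)).
  by apply/funext => x; ring.
by rewrite -[X in _ --> X](subrr (0 : R)); exact: cvgB.
Qed.

(* A minimizing geodesic attains the lower bound of its length, so that Young's
   inequality is an equality at each time. *)
Lemma minimizing_geodesic_unique q : minimizing_geodesic r q -> q 0 = id ->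
  q 1 = linear_path g r 1 -> forall t, 0 <= t <= 1 -> q t = linear_path g r t.
Proof.
move=> [[pq [c qc] _] qmin] q0 q1 t t01.
have z01 : (0 : R) < 1 by exact: ltr01.
have z0 : (0 : R) <= (0 : R) <= 1 by rewrite lexx ler01.
have z1 : (0 : R) <= (1 : R) <= 1 by rewrite lexx ler01.
have pp := linear_path_is_path r wg m0 m1 mg (lexx 0) z01 (lexx 1).
have [e _ sd] := Winf_small_ex (WinfZ r wg).
set N := \int[mu]_x (`|r * g x| `^ r).
have N0 : 0 <= N by apply: Rintegral_ge0 => x _; exact: powR_ge0.
(* The linear path is a competitor of length N^(1/r), and q has length c, its constant speed. *)
have cN : c <= N `^ r^-1.
  have := qmin _ pp; rewrite linear_path0 => /(_ (esym q0) (esym q1)).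
  rewrite linear_path_length// subr0 mulr1 /path_length.
  rewrite (eq_integral (fun=> c%:E)); last by move=> s /set_mem; exact: qc.
  by rewrite integral_cst//= lebesgue_measure_itv/= lte_fin z01 -EFinD subr0 mule1 lee_fin.
(* Constant speed turns the bound on the length into a bound at each time. *)
have I_le s : 0 <= s <= 1 -> \int[mu]_x (`|root_velocity r 0 1 q s x| `^ r) <= N.
  move=> s01; have s_in : s \in `[0, 1]%R by rewrite in_itv.
  have := speedE r1 pq s01; rewrite (qc s s_in) => -[cE].
  have I0 : 0 <= \int[mu]_x (`|root_velocity r 0 1 q s x| `^ r).
    by apply: Rintegral_ge0 => x _; exact: powR_ge0.
  by move: cN; rewrite cE; apply: powR_le_inv I0 N0; rewrite invr_gt0.
have C1 := root_pairing r1 z01 pq sd.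
have rE s : 0 <= s <= 1 ->
    r * \int[mu]_x (root_velocity r 0 1 q s x * dual r (r * g x)) <= r * N.
  move=> s01; have [ez sz] := root_velocity_small r pq s01.
  apply: (le_trans (tangent_Rintegral_le r1 sz sd)).
  have -> : r * N = N + (r - 1) * N by ring.
  by rewrite lerD2r I_le.
have D1 : derive1 (id : R -> R) =1 fun=> 1 by move=> x; exact: derive1_id.
have rootq0 x : root r (q 0) x = r by rewrite q0 /root D1 powR1 mulr1.
(* By the tangent inequality the pairing has derivative at most N, and it increases by N over [0, 1]
   because the endpoints of the root curve differ by r g; so the derivative is N throughout. *)
have D_eq : forall s, 0 < s < 1 ->
    \int[mu]_x (root_velocity r 0 1 q s x * dual r (r * g x)) = N.
  apply: (C1_curve_eq z01 C1) => [s s01|].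
    by rewrite -(ler_pM2l r0) rE.
  rewrite subr0 mulr1.
  rewrite [X in _ <= _ - X](_ : _ = 0) ?subr0; last first.
    rewrite (_ : (fun x => _) = (fun=> 0)) ?Rintegral_cst ?mul0r//.
    by apply/funext => x; rewrite subrr mul0r.
  rewrite le_eqVlt; apply/orP; left; apply/eqP; apply: eq_Rintegral => x _.
  rewrite q1 (root_linear_path x z1) rootq0 (_ : _ - r = r * g x) ?mul_dual//.
  by move: (g x) => y; ring.
have vE s : 0 < s < 1 -> root_velocity r 0 1 q s =1 (fun x => r * g x).
  move=> s01; have s01' : 0 <= s <= 1 by lra.
  have [ez sz] := root_velocity_small r pq s01'.
  apply: (tangent_Rintegral_eq r1 sz sd); rewrite D_eq//.
  have -> : r * N = N + (r - 1) * N by ring.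
  by rewrite lerD2r I_le.
have t_in : t \in `[0, 1]%R by rewrite in_itv.
have [Dt _ _ _] := pq t t_in.
apply: (Diff_unique Dt (linear_path_Diff r wg m0 m1 mg t01)) => x.
(* At fixed x the root of [q t] starts at r and has derivative r g x, so it is r (1 + t g x); its
   r-th power recovers the derivative of [q t]. *)
have := C1_curve_affine (L1C0_curve_eval x (root_curve r1 pq))
  (fun s s01 => vE s s01 x) t01.
rewrite rootq0 subr0 => /eqP; rewrite subr_eq => /eqP E.
rewrite (is_derive_derive1 (linear_path_is_derive r wg m0 m1 mg x t01)).
have yE : derive1 (q t) x `^ r^-1 = 1 + t * g x.
  apply: (mulfI (_ : r != 0)); first by rewrite gt_eqF.
  by rewrite -/(root r (q t) x) E; ring.
rewrite -yE -powRrM mulVf ?gt_eqF// powRr1// ltW//; exact: Diff_derive1_gt0.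
Qed.

End geodesics.

Theorem corollary2p6p1 (R : realType) (r : R) (hr : 1 < r)
    (phi1 : R -> R) (hphi1 : Diff phi1) :
  exists p : R -> R -> R,
    [/\ minimizing_geodesic r p,
        joins p id phi1
      & forall q : R -> R -> R,
          minimizing_geodesic r q -> joins q id phi1 ->
          forall t : R, t \in `[0, 1]%R -> q t = p t].
Proof.
have r0 : 0 < r by exact: lt_trans hr.
pose g x := derive1 phi1 x `^ r^-1 - 1.
have wg : Winf g by exact: Diff_root_Winf.
have [_ _ [m [m0 m1 mphi]] _] := Diff_derive1 hphi1.
(* The lower bound m of [phi1'] becomes m^(1/r) for 1 + g, and m <= 1 gives k <= 1, which keeps k a
   lower bound along the whole segment. *)
pose k := m `^ r^-1.
have k0 : 0 < k by rewrite powR_gt0.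
have k1 : k <= 1.
  have <- : 1 `^ r^-1 = 1 :> R by rewrite powR1.
  by apply: ge0_ler_powR; rewrite ?nnegrE ?invr_ge0// ltW.
have kg x : k <= 1 + g x.
  have y0 := Diff_derive1_gt0 x hphi1.
  by rewrite /g addrC subrK ge0_ler_powR ?nnegrE ?invr_ge0 ?mphi// ltW.
have p1 : linear_path g r 1 = phi1.
  have z1 : (0 : R) <= (1 : R) <= 1 by rewrite lexx ler01.
  apply: (Diff_unique (linear_path_Diff r wg k0 k1 kg z1) hphi1) => x.
  rewrite (is_derive_derive1 (linear_path_is_derive r wg k0 k1 kg x z1)).
  rewrite mul1r /g addrC subrK -powRrM mulVf ?gt_eqF// powRr1// ltW//.
  exact: Diff_derive1_gt0.
exists (linear_path g r); split.
- exact: linear_path_minimizing_geodesic hr wg k0 k1 kg.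
- by split; [exact: linear_path0|].
- move=> q mq [q0 q1] t; rewrite in_itv/= => t01.
  by apply: (minimizing_geodesic_unique hr wg k0 k1 kg mq q0 _ t01); rewrite p1.
Qed.
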